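(* Let $\mathcal{W}$ be a periodic labeled wedge of period $p$ and preperiod $q$ with associated graph $\Gamma$, and for $k\ge1$ let $\Gamma_k=\Gamma/\equiv_{kp,q}$. Then the sequence of spectral determinants $(P_{\Gamma_k}(t))_{k\ge1}$ converges uniformly to $P_\Gamma(t)$ on compact subsets of the open unit disk $\mathbb{D}$. As a consequence, roots of $P_\Gamma$ in $\mathbb{D}$ are approximated arbitrarily well by roots of $P_{\Gamma_k}$.
   Context: $\Sigma=\{(i,j)\in\mathbb{N}^2:1\le i\le j\}$; a labeled wedge is $\Phi:\Sigma\to\{N,S,E\}$. Its graph $\Gamma$: vertices $\Sigma$; no edges out of $E$-vertices; $(i,j)\to(i+1,j+1)$ out of $N$-vertices; $(i,j)\to(1,i+1)$ and $(i,j)\to(1,j+1)$ out of $S$-vertices. For $p\ge1,q\ge0$: $i\equiv_{p,q}j$ iff $i=j$ or ($\min\{i,j\}\ge q+1$ and $i\equiv j\bmod p$); on $\Sigma$, $(i,j)\equiv_{p,q}(k,l)$ iff ($i\equiv_{p,q}k$, $j\equiv_{p,q}l$) or ($i\equiv_{p,q}l$, $j\equiv_{p,q}k$). $\mathcal{W}$ is periodic of period $p$ and preperiod $q$ if equivalent vertices have equal labels and $(i,j)$ is labeled $E$ iff $i\equiv_{p,q}j$. $\Gamma_k$ is the quotient graph by $\equiv_{kp,q}$: vertices are classes and the number of edges $[v]\to[w]$ is the number of edges from $v$ to members of $[w]$. A simple cycle is a non-self-intersecting closed path up to cyclic permutation; a multicycle is a finite (possibly empty) union of simple cycles with disjoint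 vertex sets, of length $\ell(\gamma)$ (total edges) and with $C(\gamma)$ components. The spectral determinant is $P(t)=\sum_\gamma(-1)^{C(\gamma)}t^{\ell(\gamma)}$; for $\Gamma$ this is a power series (finitely many multicycles of each length) converging on $\mathbb{D}$. *)

(* Defs.v *)
From HB Require Import structures.
From mathcomp Require Import all_boot all_order all_algebra.
From mathcomp Require Import finmap.
From mathcomp Require Import all_classical all_reals all_analysis.
From mathcomp Require Import complex.
Import Order.TTheory GRing.Theory Num.Theory.
Import numFieldTopology.Exports numFieldNormedType.Exports.

Set Implicit Arguments.
Unset Strict Implicit.
Unset Printing Implicit Defensive.
Local Open Scope ring_scope.

HB.instance Definition _ (R : realType) := PseudoPointedMetric.copy R[i] (R[i])^o.
HB.instance Definition _ (R : realType) := NormedModule.copy R[i] (R[i])^o.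

Definition Sigma := {x : nat * nat | (0 < x.1)%N && (x.1 <= x.2)%N}.

Definition s11 : Sigma := exist _ (1%N, 1%N) isT.

(* the vertex (i,j) (only used when 1 <= i <= j, where it is exact) *)
Definition mkS (i j : nat) : Sigma := insubd s11 (i, j).

Definition vi (v : Sigma) : nat := (val v).1.
Definition vj (v : Sigma) : nat := (val v).2.

Inductive label := LN | LS | LE.

Definition eqvn (p q i j : nat) : bool :=
  (i == j) || ((q < minn i j)%N && (i == j %[mod p])).

Definition eqvS (p q : nat) (v w : Sigma) : bool :=
  (eqvn p q (vi v) (vi w) && eqvn p q (vj v) (vj w))
  || (eqvn p q (vi v) (vj w) && eqvn p q (vj v) (vi w)).

Definition periodic_wedge (Phi : Sigma -> label) (p q : nat) : Prop :=
  [/\ (0 < p)%N,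
      (forall v w, eqvS p q v w -> Phi v = Phi w) &
      (forall v, Phi v = LE <-> eqvn p q (vi v) (vj v))].

Record mgraph := MGraph {
  gvert : choiceType;
  gedge : choiceType;
  gsrc : gedge -> gvert;
  gtgt : gedge -> gvert }.

(* edges are pairs (v, b): an N-vertex has the single edge (v,false),
   an S-vertex has the two edges (v,false), (v,true), an E-vertex none. *)
Definition edge_ok (Phi : Sigma -> label) (e : Sigma * bool) : bool :=
  match Phi e.1 with LN => ~~ e.2 | LS => true | LE => false end.

Definition GEdge (Phi : Sigma -> label) := {e : Sigma * bool | edge_ok Phi e}.

Definition Gsrc (Phi : Sigma -> label) (e : GEdge Phi) : Sigma := (val e).1.

Definition Gtgt (Phi : Sigma -> label) (e : GEdge Phi) : Sigma :=
  let v := (val e).1 in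
  match Phi v with
  | LN => mkS (vi v).+1 (vj v).+1
  | _ => if (val e).2 then mkS 1 (vj v).+1 else mkS 1 (vi v).+1
  end.

Definition Gamma (Phi : Sigma -> label) : mgraph :=
  @MGraph Sigma (GEdge Phi) (@Gsrc Phi) (@Gtgt Phi).

Definition eqcls (m q : nat) (v : Sigma) : set Sigma := [set w | eqvS m q v w].

Definition QVert (m q : nat) := {A : set Sigma | exists v, A = eqcls m q v}.
HB.instance Definition _ m q := gen_eqMixin (QVert m q).
HB.instance Definition _ m q := gen_choiceMixin (QVert m q).

Definition qcls (m q : nat) (v : Sigma) : QVert m q :=
  exist _ (eqcls m q v) (ex_intro _ v erefl).

Definition qrep (m q : nat) (A : QVert m q) : Sigma := projT1 (cid (proj2_sig A)).

(* edges out of the class [v]: the edges of Gamma out of the chosen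
   representative of [v]; the edge e goes from [src e] to [tgt e].  Hence the
   number of edges [v] -> [w] is the number of edges from (the representative)
   v to members of [w]. *)
Definition QEdge (Phi : Sigma -> label) (m q : nat) :=
  {e : GEdge Phi | Gsrc e == qrep (qcls m q (Gsrc e))}.

Definition Qsrc Phi m q (e : QEdge Phi m q) : QVert m q := qcls m q (Gsrc (val e)).
Definition Qtgt Phi m q (e : QEdge Phi m q) : QVert m q := qcls m q (Gtgt (val e)).

Definition quotG (Phi : Sigma -> label) (m q : nat) : mgraph :=
  @MGraph (QVert m q) (QEdge Phi m q) (@Qsrc Phi m q) (@Qtgt Phi m q).

Definition GammaK (Phi : Sigma -> label) (p q k : nat) : mgraph :=
  quotG Phi (k * p) q.

Section Cycles.
Variable G : mgraph.

Definition follows (e f : gedge G) : bool := gtgt e == gsrc f.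

(* a simple cycle, up to cyclic permutation, is identified with its set of
   edges: the edge set of a nonempty closed path e_0 ... e_{l-1} whose
   vertices gsrc e_0, ..., gsrc e_{l-1} are pairwise distinct *)
Definition simple_cycle (S : {fset gedge G}) : Prop :=
  exists s : seq (gedge G),
    [/\ s != [::], uniq (map (@gsrc G) s), path.cycle follows s & S = [fset x | x in s]%fset].

Definition cvert (S : {fset gedge G}) : {fset gvert G} :=
  [fset gsrc e | e in S]%fset.

Definition multicycle (g : {fset {fset gedge G}}) : Prop :=
  (forall S, S \in g -> simple_cycle S) /\
  (forall S T, S \in g -> T \in g -> S != T -> fdisjoint (cvert S) (cvert T)).

Definition mlength (g : {fset {fset gedge G}}) : nat := (\sum_(S <- g) #|` S|)%N.
Definition ncomp (g : {fset {fset gedge G}}) : nat := #|` g|.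

Definition sd_coef (R : realType) (n : nat) : R[i] :=
  \sum_(g \in [set g | multicycle g /\ mlength g = n]) ((-1 : R[i]) ^+ ncomp g).

Definition specdet (R : realType) (t : R[i]) : R[i] :=
  limn (series (fun n => sd_coef R n * t ^+ n)).
End Cycles.

(* Main.v *)
Require Import Defs.
From HB Require Import structures.
From mathcomp Require Import all_boot all_order all_algebra.
From mathcomp Require Import finmap.
From mathcomp Require Import all_classical all_reals all_analysis.
From mathcomp Require Import complex.
From mathcomp Require Import zify lra ring separable cyclic cyclotomic.
Import Order.TTheory GRing.Theory Num.Theory.
Import numFieldTopology.Exports numFieldNormedType.Exports.
Set Implicit Arguments.
Unset Strict Implicit.
Unset Printing Implicit Defensive.
Local Open Scope ring_scope.
Local Open Scope classical_set_scope.

(* Folding every coordinate into [1, q+M], M = kp, identifies Gamma_k with the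
   graph obtained from Gamma by folding the targets of its edges.  An S-edge
   (a,b) -> (1,a+1) is called low; every other edge raises the larger coordinate
   by one, or wraps around when that coordinate is q+M.  Along an edge the sum of
   the coordinates grows by at most 2, while a low edge leaving (a,b) loses b and a
   wrap loses M.  Summing over a multicycle of length n, the heights of the sources
   of its low edges add up to at most 2n, so there are O(sqrt n) low edges (their
   targets (1,a+1) are distinct), and there are at most 2n/M wraps.  All other edges
   are determined by their source and every cycle contains a low edge or a wrap, so
   a multicycle is determined by its low edges and wraps.  Hence the number of
   multicycles of length n is subexponential in n, uniformly for large k.  If
   2n < M there are no wraps and the multicycles of length n are those of Gamma.
   The two facts give the uniform convergence.

   The approximants are polynomials with constant term 1, for which Hurwitz'
   theorem is proved by elementary means: a minimum principle (evaluate the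
   polynomial at the roots of X^N - r^N and let N grow), Cauchy's estimates (average
   over roots of unity), and a Blaschke factor argument showing that the Taylor
   coefficients at the limit root cannot all tend to 0. *)

(** * Multicycles *)

Lemma uniq_map_in_inj (A B : eqType) (f : A -> B) (s : seq A) :
  uniq (map f s) -> {in s &, injective f}.
Proof.
move=> us x y xs ys fxy; apply/eqP.
rewrite -(nth_index x xs) -(nth_index x ys) nth_uniq ?index_mem ?(map_uniq us) //.
rewrite -(nth_uniq (f x) _ _ us) ?size_map ?index_mem //.
by rewrite !(nth_map x) ?index_mem // !nth_index // fxy.
Qed.

Section SimpleCycle.
Variable G : mgraph.
Implicit Types (S T : {fset gedge G}) (e f : gedge G) (g h : {fset {fset gedge G}}).

(** The target of each edge is the source of its successor, so listing targets shifts the list of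
    sources by one place. *)
Lemma cycle_tgt (s : seq (gedge G)) :
  path.cycle (@follows G) s -> map (@gtgt G) s = rot 1 (map (@gsrc G) s).
Proof.
case: s => [|x s] //=; rewrite rot1_cons -map_rcons.
elim: s {1 3}x => [|y s IHs] z /=; first by rewrite andbT => /eqP ->.
by case/andP=> /eqP -> /IHs ->.
Qed.

Lemma simple_cycle_neq0 S : simple_cycle S -> exists e, e \in S.
Proof. by case=> [[|e s] [] // _ _ _ ->]; exists e; rewrite !inE eqxx. Qed.

Lemma simple_cycle_perm S : simple_cycle S ->
  perm_eq (map (@gtgt G) (enum_fset S)) (map (@gsrc G) (enum_fset S))
  /\ uniq (map (@gsrc G) (enum_fset S)).
Proof.
case=> s [_ us cs ->].
have ps : perm_eq (enum_fset [fset x | x in s]%fset) s.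
  apply: uniq_perm; rewrite ?fset_uniq ?(map_uniq us)//.
  by move=> x; rewrite !inE.
split; last by rewrite (perm_uniq (perm_map _ ps)).
apply: (perm_trans (perm_map _ ps)); rewrite (permPr (perm_map _ ps)).
by rewrite (cycle_tgt cs) perm_rot.
Qed.

Lemma simple_cycle_next S e : simple_cycle S -> e \in S ->
  exists2 f, f \in S & follows e f.
Proof.
case=> s [_ us cs ->]; rewrite !inE => es.
exists (next s e); last exact: next_cycle.
by rewrite !inE mem_next.
Qed.

Lemma simple_cycle_ind S (P : gedge G -> Prop) e0 : simple_cycle S ->
  e0 \in S -> P e0 ->
  (forall e f, e \in S -> f \in S -> P e -> follows e f -> P f) ->
  forall e, e \in S -> P e.
Proof.
case=> s [_ us cs ->]; rewrite !inE => e0s P0 IH.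
have [i s' def_s] := rot_to e0s.
have mem_s x : x \in e0 :: s' -> x \in s by rewrite -def_s mem_rot.
move: cs; rewrite -(rot_cycle i) def_s /= rcons_path => /andP[ps _] e.
rewrite !inE -(mem_rot i) def_s.
elim: s' e0 P0 ps mem_s {e0s def_s} => [|y s' IHs] x Px /=.
  by move=> _ _; rewrite inE => /eqP ->.
case/andP=> xy ps mem_s; rewrite inE => /predU1P[-> //|].
apply: IHs => //; last by move=> z zs; apply: mem_s; rewrite inE zs orbT.
by apply: IH xy => //; rewrite !inE; apply: mem_s; rewrite !inE eqxx ?orbT.
Qed.

Definition medges g : seq (gedge G) := flatten (map (@enum_fset _) (enum_fset g)).

Lemma mem_medges g e : reflect (exists2 S, S \in g & e \in S) (e \in medges g).
Proof.
exact: flatten_mapP.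
Qed.

Lemma size_medges g : size (medges g) = mlength g.
Proof.
rewrite size_flatten /shape -map_comp sumnE big_map /mlength.
by [].
Qed.

(** Conservation law behind all cost estimates: a multicycle enters each vertex as often as it
    leaves it, so a vertex function has the same sum over targets as over sources. *)
Lemma perm_medges g : multicycle g ->
  perm_eq (map (@gtgt G) (medges g)) (map (@gsrc G) (medges g)).
Proof.
case=> cg _; rewrite /medges !map_flatten.
elim: (enum_fset g) (cg : forall S, S \in enum_fset g -> simple_cycle S) => // S s IHs cs /=.
apply: perm_cat; last by apply: IHs => T Ts; apply: cs; rewrite inE Ts orbT.
by have [] := simple_cycle_perm (cs S (mem_head _ _)).
Qed.

Lemma uniq_medges g : multicycle g -> uniq (map (@gsrc G) (medges g)).
Proof.
case=> cg dg; rewrite /medges !map_flatten.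
have := fset_uniq g.
elim: (enum_fset g) (cg : forall S, S \in enum_fset g -> simple_cycle S)
  (dg : forall S T, S \in enum_fset g -> T \in enum_fset g -> _) => // S s IHs cs ds /= /andP[Ss us].
rewrite cat_uniq IHs //; last 2 first.
- by move=> T Ts; apply: cs; rewrite inE Ts orbT.
- by move=> T T' Ts Ts'; apply: ds; rewrite inE ?Ts ?Ts' orbT.
have [_ ->] := simple_cycle_perm (cs S (mem_head _ _)); rewrite andbT /=.
apply/hasPn => x; rewrite -map_comp => xs.
have /flatten_mapP[T Ts /mapP[e eT ->]] : x \in flatten [seq map (@gsrc G) (enum_fset T) | T <- s] := xs.
apply/negP => /mapP[f fS ef].
have ST : S != T by apply: contraNneq Ss => ->.
have /fdisjointP/(_ (gsrc e)) := ds S T (mem_head _ _) (mem_behead (Ts : T \in behead (S :: s))) ST.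
have -> : gsrc e \in cvert S by rewrite ef; apply/imfsetP; exists f.
move/(_ isT)/negP; apply; by apply/imfsetP; exists e.
Qed.

Lemma medges_src_inj g e f : multicycle g ->
  e \in medges g -> f \in medges g -> gsrc e = gsrc f -> e = f.
Proof.
by move=> mg; apply: uniq_map_in_inj (uniq_medges mg) _ _.
Qed.

Lemma medges_tgt_inj g e f : multicycle g ->
  e \in medges g -> f \in medges g -> gtgt e = gtgt f -> e = f.
Proof.
move=> mg; have := uniq_medges mg.
by rewrite -(perm_uniq (perm_medges mg)) => ug; apply: uniq_map_in_inj ug _ _.
Qed.


Lemma medges_next g e : multicycle g -> e \in medges g ->
  exists2 f, f \in medges g & follows e f.
Proof.
case=> cg _ /mem_medges[S Sg eS]; have [f fS ef] := simple_cycle_next (cg S Sg) eS.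
by exists f => //; apply/mem_medges; exists S.
Qed.

(** A multicycle has at most one edge out of each vertex, so the component through a given edge is
    recovered by following edges. The edge set alone thus determines the decomposition into
    cycles. *)
Lemma multicycle_sub g h : multicycle g -> multicycle h ->
  {subset medges g <= medges h} -> {subset medges h <= medges g} -> {subset g <= h}.
Proof.
move=> mg mh gh hg S Sg; have cS := mg.1 S Sg.
have [e0 e0S] := simple_cycle_neq0 cS.
have inG T e : T \in g -> e \in T -> e \in medges g by move=> *; apply/mem_medges; exists T.
have inH T e : T \in h -> e \in T -> e \in medges h by move=> *; apply/mem_medges; exists T.
have /gh/mem_medges[T Th e0T] := inG _ _ Sg e0S; have cT := mh.1 T Th.
suff -> : S = T by [].
apply/fsetP => e; apply/idP/idP.
  move: e; apply: (simple_cycle_ind cS e0S e0T) => e f eS fS eT ef.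
  have [f' f'T ef'] := simple_cycle_next cT eT.
  have ff' : gsrc f = gsrc f' by rewrite -(eqP ef) -(eqP ef').
  by rewrite (medges_src_inj mh (gh _ (inG _ _ Sg fS)) (inH _ _ Th f'T) ff').
move: e; apply: (simple_cycle_ind cT e0T e0S) => e f eT fT eS ef.
have [f' f'S ef'] := simple_cycle_next cS eS.
have ff' : gsrc f = gsrc f' by rewrite -(eqP ef) -(eqP ef').
by rewrite (medges_src_inj mg (hg _ (inH _ _ Th fT)) (inG _ _ Sg f'S) ff').
Qed.

Section Special.
Variable sp : pred (gedge G).
Hypothesis sp_cycle : forall S, simple_cycle S -> exists2 e, e \in S & sp e.
Hypothesis nsp_det : forall e f, ~~ sp e -> ~~ sp f -> gsrc e = gsrc f -> e = f.

(** Walk along a cycle of [g] from a special edge, which [h] shares. At each vertex [h] continues as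
    well; two continuations that are not special agree by [nsp_det], and a special one belongs to
    both multicycles. *)
Lemma medges_sub_special g h : multicycle g -> multicycle h ->
  (forall e, sp e -> (e \in medges g) = (e \in medges h)) ->
  {subset medges g <= medges h}.
Proof.
move=> mg mh gh e /mem_medges[S Sg eS]; have cS := mg.1 S Sg.
have inG x : x \in S -> x \in medges g by move=> *; apply/mem_medges; exists S.
have [e0 e0S spe0] := sp_cycle cS; have e0h : e0 \in medges h by rewrite -gh ?inG.
move: e eS; apply: (simple_cycle_ind cS e0S e0h).
move=> e f eS fS eh ef; have [f' f'h ef'] := medges_next mh eh.
have [spf|nspf] := boolP (sp f); first by rewrite -gh ?inG.
have ff' : gsrc f = gsrc f' by rewrite -(eqP ef) -(eqP ef').
have [spf'|nspf'] := boolP (sp f'); last by rewrite (nsp_det nspf nspf' ff').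
(* A special continuation [f'] of [h] also lies in [g], which has only one edge out of that
   vertex. *)
by rewrite (medges_src_inj mg (inG _ fS) _ ff') ?gh.
Qed.

Lemma multicycle_eq_special g h : multicycle g -> multicycle h ->
  (forall e, sp e -> (e \in medges g) = (e \in medges h)) -> g = h.
Proof.
move=> mg mh gh.
have sgh := medges_sub_special mg mh gh.
have shg : {subset medges h <= medges g}.
  by apply: medges_sub_special => // e spe; rewrite gh.
by apply/fsetP => S; apply/idP/idP; apply: multicycle_sub.
Qed.

End Special.

(** Every multicycle contributes a term of modulus 1, so it suffices to count them. The injective
    code also proves that there are finitely many, which turns the sum over a set into an ordinary
    finite sum. *)
Lemma norm_sd_coef_le (R : realType) n (T : finType) (P : {set T})
    (code : {fset {fset gedge G}} -> T) :
  (forall g, multicycle g -> mlength g = n -> code g \in P) ->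
  (forall g h, multicycle g -> mlength g = n -> multicycle h -> mlength h = n ->
     code g = code h -> g = h) ->
  `|sd_coef G R n| <= #|P|%:R.
Proof.
move=> codeP code_inj; rewrite /sd_coef; set D := [set g | _].
have finD : finite_set D.
  have inj : {in D &, injective code}.
    by move=> g h; rewrite !inE => -[mg lg] [mh lh]; apply: code_inj.
  by rewrite -(eq_finite_set (inj_card_eq inj)); apply: finite_finset.
rewrite fsbig_finite //=; apply: (le_trans (ler_norm_sum _ _ _)).
under eq_bigr do rewrite normrX normrN1 expr1n.
rewrite big_const_seq count_predT iter_addr_0 ler_nat cardE -(size_map code).
apply: uniq_leq_size.
  rewrite map_inj_in_uniq ?fset_uniq // => g h.
  rewrite !in_fset_set // !inE => -[mg lg] [mh lh]; exact: code_inj.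
move=> x /mapP[g]; rewrite in_fset_set // inE => -[mg lg] ->.
by rewrite mem_enum codeP.
Qed.

Lemma sd_coef_eq0 (R : realType) n :
  (forall g, multicycle g -> mlength g <> n) -> sd_coef G R n = 0.
Proof.
move=> Pn; rewrite /sd_coef (_ : [set g | _] = set0) ?fsbig_set0 //.
by apply/seteqP; split=> // g [/Pn].
Qed.

Lemma sd_coef0 (R : realType) : sd_coef G R 0 = 1.
Proof.
rewrite /sd_coef (_ : [set g | _] = [set fset0]%classic) ?fsbig_set1 ?cardfs0 ?expr0 //.
apply/seteqP; split=> [g [mg] | _ ->] /=.
  rewrite -size_medges => /size0nil g0; apply/fsetP => S; rewrite !inE.
  apply/negP => Sg; have [e eS] := simple_cycle_neq0 (mg.1 S Sg).
  have : e \in medges g by apply/mem_medges; exists S.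
  by rewrite g0.
by split; [split=> S; rewrite ?inE | rewrite /mlength big_seq_fset0].
Qed.

End SimpleCycle.

Lemma map_preimage (A B : eqType) (f : A -> B) (P : A -> Prop) (t : seq B) :
  (forall y, y \in t -> exists2 x, P x & f x = y) ->
  exists2 s, map f s = t & forall x, x \in s -> P x.
Proof.
elim: t => [|y t IHt] Pt; first by exists [::].
have [x Px <-] := Pt y (mem_head _ _).
have [|s <- Ps] := IHt; first by move=> z zt; apply: Pt; rewrite inE zt orbT.
by exists (x :: s) => // z; rewrite inE => /predU1P[->|/Ps].
Qed.

(** * Transport of spectral determinants along an embedding of graphs *)

Section Transfer.
Variables (G H : mgraph) (fe : gedge G -> gedge H) (fv : gvert G -> gvert H).
Hypothesis fe_inj : injective fe.
Hypothesis fv_inj : injective fv.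
Hypothesis fe_src : forall e, gsrc (fe e) = fv (gsrc e).
Hypothesis fe_tgt : forall e, gtgt (fe e) = fv (gtgt e).
Hypothesis fe_onto : forall (S : {fset gedge H}), simple_cycle S ->
  forall e, e \in S -> exists e', fe e' = e.

Definition map_cyc (S : {fset gedge G}) : {fset gedge H} := [fset fe x | x in S]%fset.
Definition map_mcyc (g : {fset {fset gedge G}}) : {fset {fset gedge H}} :=
  [fset map_cyc S | S in g]%fset.

Lemma mem_map_cyc e S : (fe e \in map_cyc S) = (e \in S).
Proof. by rewrite mem_imfset //=. Qed.

Lemma map_cyc_inj : injective map_cyc.
Proof. by move=> S T /fsetP ST; apply/fsetP => e; rewrite -!mem_map_cyc ST. Qed.

Lemma cycle_map_follows (s : seq (gedge G)) :
  path.cycle (@follows H) (map fe s) = path.cycle (@follows G) s.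
Proof.
have ef e f : follows (fe e) (fe f) = follows e f.
  by rewrite /follows fe_src fe_tgt inj_eq.
case: s => //= x s; rewrite -map_rcons path_map; exact: eq_path.
Qed.

Lemma simple_cycle_map S : simple_cycle S -> simple_cycle (map_cyc S).
Proof.
case=> s [s0 us cs ->]; exists (map fe s); split.
- by case: s s0 {us cs}.
- by rewrite -map_comp (eq_map fe_src) map_comp map_inj_uniq.
- by rewrite cycle_map_follows.
apply/fsetP => y; apply/imfsetP/idP => [[x /= + ->]|].
  by rewrite !inE => xs; apply: map_f.
by rewrite !inE => /mapP[x xs ->]; exists x; rewrite //= inE.
Qed.

Lemma simple_cycle_unmap T : simple_cycle T ->
  exists2 S, simple_cycle S & map_cyc S = T.
Proof.
move=> cT; have [t [t0 ut ct Tt]] := cT.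
have [|s st _] := @map_preimage _ _ fe (fun=> True) t.
  move=> e et; have [|e' <-] := fe_onto cT (e := e); first by rewrite Tt !inE.
  by exists e'.
exists [fset x | x in s]%fset.
  exists s; split => //.
  - by case: (s) st t0 => //= <-.
  - by move: ut; rewrite -st -map_comp (eq_map fe_src) map_comp map_inj_uniq.
  - by rewrite -cycle_map_follows st.
rewrite Tt -st; apply/fsetP => y; apply/imfsetP/idP => [[x /= + ->]|].
  by rewrite !inE => xs; apply: map_f.
by rewrite !inE => /mapP[x xs ->]; exists x; rewrite //= inE.
Qed.

Lemma simple_cycle_mapE S : simple_cycle (map_cyc S) <-> simple_cycle S.
Proof.
split; last exact: simple_cycle_map.
by case/simple_cycle_unmap => T cT /map_cyc_inj <-.
Qed.

Lemma cvert_map S : cvert (map_cyc S) = [fset fv x | x in cvert S]%fset.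
Proof.
apply/fsetP => v; apply/imfsetP/imfsetP => /=.
  case=> _ /imfsetP[e /= eS ->] ->; exists (gsrc e); last by rewrite fe_src.
  by apply/imfsetP; exists e.
case=> _ /imfsetP[e /= eS ->] ->; exists (fe e); last by rewrite fe_src.
by rewrite mem_map_cyc.
Qed.

Lemma fdisjoint_map S T :
  fdisjoint (cvert (map_cyc S)) (cvert (map_cyc T)) = fdisjoint (cvert S) (cvert T).
Proof.
rewrite !cvert_map; apply/fdisjointP/fdisjointP => D x.
  by move=> xS; have := D (fv x); rewrite !mem_imfset //=; apply.
by case/imfsetP => /= y yS ->; rewrite mem_imfset //=; apply: D.
Qed.

Lemma multicycle_map g : multicycle (map_mcyc g) <-> multicycle g.
Proof.
have memg S : (map_cyc S \in map_mcyc g) = (S \in g).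
  by rewrite mem_imfset //=; apply: map_cyc_inj.
split=> -[cg dg]; split.
- by move=> S Sg; apply/simple_cycle_mapE/cg; rewrite memg.
- move=> S T Sg Tg ST; rewrite -fdisjoint_map; apply: dg; rewrite ?memg //.
  by rewrite inj_eq //; apply: map_cyc_inj.
- by move=> _ /imfsetP[S /= Sg ->]; apply/simple_cycle_mapE/cg.
- move=> _ _ /imfsetP[S /= Sg ->] /imfsetP[T /= Tg ->].
  by rewrite fdisjoint_map inj_eq; [apply: dg | apply: map_cyc_inj].
Qed.

Lemma mlength_map g : mlength (map_mcyc g) = mlength g.
Proof.
rewrite /mlength big_imfset /=; last by move=> S T _ _; apply: map_cyc_inj.
by apply: eq_bigr => S _; rewrite card_imfset.
Qed.

Lemma ncomp_map g : ncomp (map_mcyc g) = ncomp g.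
Proof. by rewrite /ncomp card_imfset //; apply: map_cyc_inj. Qed.

(** Multicycles only see edges that lie on cycles, which is why [fe_onto] asks for preimages of
    those edges alone. *)
Lemma sd_coef_transfer (R : realType) n : sd_coef H R n = sd_coef G R n.
Proof.
rewrite /sd_coef (reindex_fsbig map_mcyc [set g | multicycle g /\ mlength g = n]).
  by apply: eq_fsbigr => g _; rewrite ncomp_map.
split.
- by move=> g [mg lg]; split; [apply/multicycle_map | rewrite mlength_map].
- move=> g h _ _ /fsetP gh; apply/fsetP => S; have := gh (map_cyc S).
  by rewrite !mem_imfset //=; apply: map_cyc_inj.
- move=> h [mh lh].
  have [|s sh _] := @map_preimage _ _ map_cyc (fun=> True) (enum_fset h).
    by move=> T Th; have [S _ <-] := simple_cycle_unmap (mh.1 T Th); exists S.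
  have hE : map_mcyc [fset S | S in s]%fset = h.
    apply/fsetP => T; rewrite -[RHS]/(T \in enum_fset h) -sh.
    apply/imfsetP/mapP => /= -[S Ss ->]; exists S => //; first by rewrite inE in Ss.
    by rewrite inE.
  by exists [fset S | S in s]%fset; rewrite // /=; split;
    [apply/multicycle_map; rewrite hE | rewrite -mlength_map hE].
Qed.

End Transfer.

(** * Folding the quotient graphs *)

Lemma viE i j : (0 < i <= j)%N -> vi (mkS i j) = i.
Proof. by move=> ij; rewrite /vi /mkS insubdK. Qed.

Lemma vjE i j : (0 < i <= j)%N -> vj (mkS i j) = j.
Proof. by move=> ij; rewrite /vj /mkS insubdK. Qed.

Lemma SigmaP v : (0 < vi v <= vj v)%N.
Proof. exact: (valP v). Qed.

Lemma Sigma_eq v w : vi v = vi w -> vj v = vj w -> v = w.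
Proof.
by rewrite /vi /vj => vw vw'; apply: val_inj; rewrite (surjective_pairing (val v)) vw vw' -surjective_pairing.
Qed.

Section Fold.
Variables (M q : nat).
Hypothesis M0 : (0 < M)%N.

(** The least representative of the class of [i]: classes beyond the preperiod are represented in
    [q+1, q+M]. *)
Definition fold i := if (i <= q)%N then i else (q.+1 + (i - q.+1) %% M)%N.

Lemma fold_le i : (fold i <= q + M)%N.
Proof. rewrite /fold; case: ifP => iq; first lia; have := ltn_pmod (i - q.+1) M0; lia. Qed.

Lemma fold_gt0 i : (0 < i)%N -> (0 < fold i)%N.
Proof. by rewrite /fold; case: ifP. Qed.

Lemma fold_id i : (i <= q + M)%N -> fold i = i.
Proof. by rewrite /fold; case: ifP => // iq iM; rewrite modn_small; lia. Qed.

(** Edges act on coordinates by successor or by resetting to 1; compatibility with successor lets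
    them descend to folded coordinates. *)
Lemma foldS i : fold (fold i).+1 = fold i.+1.
Proof.
rewrite {2}/fold; case: ifP => // iq; rewrite /fold ifF; last lia.
rewrite ifF; last lia.
congr (_ + _)%N; have -> : ((q.+1 + (i - q.+1) %% M).+1 - q.+1 = (i - q.+1) %% M + 1)%N by lia.
by rewrite modnDml; congr (_ %% _)%N; lia.
Qed.

Lemma fold_wrap : fold (q + M).+1 = q.+1.
Proof. by rewrite /fold ifF; [rewrite (_ : _ - _ = M)%N ?modnn; lia | lia]. Qed.

Lemma eqvn_fold i j : eqvn M q i j = (fold i == fold j).
Proof.
rewrite /eqvn; have [<-|ij] /= := eqVneq i j; first by rewrite eqxx.
rewrite /fold; case: (leqP i q) => iq; case: (leqP j q) => jq.
- by rewrite (negbTE ij); lia.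
- by lia.
- by lia.
by rewrite eqn_add2l leq_min iq jq /= -[RHS](eqn_modDr q.+1) !subnK.
Qed.

(** The canonical representative of a class of vertices. Folding may reverse the order of the
    coordinates, hence the minimum and maximum. *)
Definition red v := mkS (minn (fold (vi v)) (fold (vj v))) (maxn (fold (vi v)) (fold (vj v))).

Lemma vi_red v : vi (red v) = minn (fold (vi v)) (fold (vj v)).
Proof. by rewrite viE //; have := SigmaP v; have := @fold_gt0 (vi v); have := @fold_gt0 (vj v); lia. Qed.

Lemma vj_red v : vj (red v) = maxn (fold (vi v)) (fold (vj v)).
Proof. by rewrite vjE //; have := SigmaP v; have := @fold_gt0 (vi v); have := @fold_gt0 (vj v); lia. Qed.

Lemma eqvS_red v w : eqvS M q v w = (red v == red w).
Proof.
rewrite /eqvS !eqvn_fold; apply/idP/eqP => [vw|/[dup] /(congr1 vi) + /(congr1 vj)].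
  by apply: Sigma_eq; rewrite ?vi_red ?vj_red; lia.
by rewrite !vi_red !vj_red; lia.
Qed.

Lemma red_le v : (vj (red v) <= q + M)%N.
Proof. by rewrite vj_red geq_max !fold_le. Qed.

Lemma red_id v : (vj v <= q + M)%N -> red v = v.
Proof.
move=> vM; have := SigmaP v => vP.
by apply: Sigma_eq; rewrite ?vi_red ?vj_red !fold_id; lia.
Qed.

Lemma redK v : red (red v) = red v.
Proof. exact/red_id/red_le. Qed.

Lemma eqvS_redl v : eqvS M q v (red v).
Proof. by rewrite eqvS_red redK. Qed.

Lemma eq_qcls v w : (qcls M q v = qcls M q w) <-> red v = red w.
Proof.
split=> [/(congr1 (@proj1_sig _ _))/= vw|vw].
  have : eqcls M q w v by rewrite -vw /eqcls /= eqvS_red.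
  by rewrite /eqcls /= eqvS_red => /eqP ->.
by apply: eq_exist; apply/seteqP; split=> u; rewrite /eqcls /= !eqvS_red vw.
Qed.

Lemma qcls_qrep (A : QVert M q) : qcls M q (qrep A) = A.
Proof.
case: A => A PA; apply: eq_exist; rewrite /qrep /=.
by case: cid.
Qed.

Lemma red_qrep v : red (qrep (qcls M q v)) = red v.
Proof. by apply/eq_qcls; rewrite qcls_qrep. Qed.

End Fold.

(** All vertices and edges of [Gamma] are kept and only targets are folded. For [rho] equal to
    [red], cycles pass through reduced vertices only, so the surplus vertices do not affect the
    determinant. *)
Definition foldedG (Phi : Sigma -> label) (rho : Sigma -> Sigma) : mgraph :=
  @MGraph Sigma (GEdge Phi) (@Gsrc Phi) (fun e => rho (Gtgt e)).

Section FoldQuotient.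
Variables (Phi : Sigma -> label) (M q : nat).
Hypothesis M0 : (0 < M)%N.
Hypothesis Phi_eqv : forall v w, eqvS M q v w -> Phi v = Phi w.
Local Notation red := (red M q).
Local Notation fold := (fold M q).

Lemma Phi_red v : Phi (red v) = Phi v.
Proof. by apply/esym/Phi_eqv; apply: eqvS_redl. Qed.

(** The flag of an S-edge tells which coordinate is incremented, so it must be flipped when folding
    exchanges the two coordinates. *)
Definition swap_flag (v : Sigma) (b : bool) :=
  if Phi v is LS then b (+) (fold (vj v) < fold (vi v))%N else b.

Lemma swap_flagK v : involutive (swap_flag v).
Proof. by move=> b; rewrite /swap_flag; case: (Phi v) => //; rewrite -addbA addbb addbF. Qed.

Lemma red_edge_ok (e : GEdge Phi) :
  edge_ok Phi (red (val e).1, swap_flag (val e).1 (val e).2).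
Proof. by have := valP e; rewrite /edge_ok /= Phi_red /swap_flag; case: (Phi _). Qed.

Definition red_edge (e : GEdge Phi) : GEdge Phi :=
  exist (fun x => is_true (edge_ok Phi x)) _ (red_edge_ok e).

Lemma red_tgt e : red (Gtgt (red_edge e)) = red (Gtgt e).
Proof.
case: e => -[v b] /= ok; rewrite /Gtgt /= Phi_red /swap_flag.
apply/eqP; rewrite -eqvS_red //; apply/eqP.
have := SigmaP v => vP; have := @fold_gt0 M q (vi v); have := @fold_gt0 M q (vj v) => v1 v2.
have S1 := @foldS M q M0 (vi v); have S2 := @foldS M q M0 (vj v).
case Pv: (Phi v) ok => [||]; rewrite /edge_ok /= Pv ?vi_red ?vj_red // /eqvS => ok.
  rewrite !eqvn_fold // !viE ?vjE; [|lia..].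
  by case: (leqP (fold (vi v)) (fold (vj v))) => h; rewrite S1 S2 !eqxx ?orbT.
rewrite !eqvn_fold //; case: b {ok};
  case: (ltnP (fold (vj v)) (fold (vi v))) => h; rewrite /= !viE ?vjE; try lia;
  by rewrite ?S1 ?S2 !eqxx.
Qed.

(** The edges of [quotG] leave representatives obtained by choice; [red_edge] moves them to the
    reduced vertices, bijectively onto the edges that can lie on a cycle. *)
Lemma sd_coef_quotG (R : realType) n :
  sd_coef (quotG Phi M q) R n = sd_coef (foldedG Phi red) R n.
Proof.
apply/esym/(@sd_coef_transfer (quotG Phi M q) (foldedG Phi red) (fun e : QEdge Phi M q => red_edge (val e))
  (fun A : QVert M q => red (qrep A))).
- move=> e f /(congr1 val)[+ bf].
  move: bf; case: e f => e /= eP [f /= fP] bf ef.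
  apply: val_inj => /=.
  (* Sources with the same reduction share a class, and quotient edges leave only its chosen
     representative. *)
  have vv : (sval e).1 = (sval f).1.
    rewrite -[LHS]/(Gsrc e) -[RHS]/(Gsrc f) (eqP eP) (eqP fP).
    by congr qrep; apply/eq_qcls.
  apply: val_inj; rewrite /= (surjective_pairing (sval e)) [RHS]surjective_pairing vv.
  by congr pair; apply: (can_inj (swap_flagK (sval f).1)); rewrite -bf vv.
- by move=> A B AB; rewrite -(qcls_qrep A) -(qcls_qrep B); apply/eq_qcls.
- by move=> e /=; rewrite /Qsrc red_qrep.
- by move=> e /=; rewrite /Qtgt red_qrep // red_tgt.
move=> S cS e eS.
(* A vertex on a cycle is the target of some edge, hence reduced. *)
have rse : red (Gsrc e) = Gsrc e.
  have [ps _] := simple_cycle_perm cS.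
  have : Gsrc e \in map (@gsrc (foldedG Phi red)) (enum_fset S) by apply: (map_f (@gsrc (foldedG Phi red))).
  by rewrite -(perm_mem ps) => /mapP[f _ ->] /=; rewrite redK.
pose v := qrep (qcls M q (Gsrc e)).
have rv : red v = Gsrc e by rewrite /v red_qrep.
have Phiv : Phi v = Phi (Gsrc e) by rewrite -rv Phi_red.
have ok : edge_ok Phi (v, swap_flag v (val e).2).
  have := valP e; rewrite /edge_ok /= -/(Gsrc e) Phiv /swap_flag Phiv.
  by case: (Phi _).
pose f : GEdge Phi := exist (fun x => is_true (edge_ok Phi x)) _ ok.
have fP : Gsrc f == qrep (qcls M q (Gsrc f)).
  rewrite /Gsrc /=; apply/eqP; rewrite {1}/v; congr qrep; apply/eq_qcls => //.
  by rewrite rv.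
have fe : red_edge f = e :> GEdge Phi.
  by apply: val_inj; rewrite /= swap_flagK rv [RHS]surjective_pairing.
by exists (exist (fun e => is_true (Gsrc e == qrep (qcls M q (Gsrc e)))) f fP : QEdge Phi M q).
Qed.

End FoldQuotient.

(** * Counting multicycles *)

Lemma exists_max_seq (T : eqType) (F : T -> nat) (x : T) (s : seq T) :
  exists2 y, y \in x :: s & forall z, z \in x :: s -> (F z <= F y)%N.
Proof.
elim: s x => [|y s IHs] x.
  by exists x; rewrite ?mem_head // => z; rewrite inE => /eqP ->.
have [z zs zmax] := IHs y; have [xz|zx] := leqP (F x) (F z).
  by exists z => [|w]; rewrite inE ?zs ?orbT // => /predU1P[->|/zmax].
exists x => [|w]; rewrite inE ?eqxx // => /predU1P[->//|/zmax wz].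
exact: leq_trans wz (ltnW zx).
Qed.

(** Distinct positive integers add up to at least 1 + 2 + ... + [size s]. In the induction,
    pigeonhole yields an entry at least as large as the size, and it is removed. *)
Lemma uniq_sum_ge (s : seq nat) : uniq s -> (forall x, x \in s -> (0 < x)%N) ->
  (size s * (size s).+1 <= 2 * \sum_(x <- s) x)%N.
Proof.
move: {2}(size s) (erefl (size s)) => n; elim: n s => [|n IHn] s.
  by move=> ->.
move=> sn us s0; have [x xs nx] : exists2 x, x \in s & (n < x)%N.
  apply/hasP; apply: contraTT isT => /hasPn ns.
  have := @uniq_leq_size _ s (iota 1 n) us; rewrite sn size_iota ltnn; apply.
  by move=> x xs; rewrite mem_iota s0 //= add1n ltnS leqNgt ns.
have sr : size (rem x s) = n by rewrite size_rem // sn.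
have := IHn (rem x s) sr (rem_uniq _ us) (fun y ys => s0 y (mem_rem ys)).
rewrite sr sn (perm_big _ (perm_to_rem xs)) big_cons /=.
by move: (\sum_(_ <- _) _)%N => t; nia.
Qed.

(** A set with at most [r] elements is coded by the list of its elements, padded with [None] to
    length [r]. *)
Lemma card_small_sets (T : finType) r :
  (#|[set A : {set T} | (#|A| <= r)%N]%SET| <= #|T|.+1 ^ r)%N.
Proof.
pose f (A : {set T}) := [ffun i : 'I_r => nth None (map some (enum A)) i].
rewrite -card_option -[X in (_ ^ X)%N]card_ord -card_ffun -(@card_in_imset _ _ f).
  exact: max_card.
move=> A B; rewrite !inE => Ar Br fAB.
have memA (C : {set T}) x : (#|C| <= r)%N -> (x \in C) = [exists i : 'I_r, f C i == Some x].
  move=> Cr; apply/idP/existsP => [xC | [i Ci]].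
    have ir : (index x (enum C) < r)%N.
      by apply: leq_trans Cr; rewrite cardE index_mem mem_enum.
    by exists (Ordinal ir); rewrite ffunE /= (nth_map x) ?nth_index ?index_mem ?mem_enum.
  move: Ci; rewrite ffunE; have [iC|Ci] := ltnP i (size (enum C)).
    by rewrite (nth_map x) // => /eqP[<-]; rewrite -mem_enum mem_nth.
  by rewrite nth_default // size_map.
by apply/setP => x; rewrite !memA // fAB.
Qed.

(** Summed over the multicycle, the potential [s] cancels between sources and targets, leaving at
    most 2 per edge for the cost. *)
Lemma mlength_cost (G : mgraph) (s : gvert G -> nat) (cost : gedge G -> nat)
    (g : {fset {fset gedge G}}) : multicycle g ->
  (forall e, e \in medges g -> (s (gtgt e) + cost e <= s (gsrc e) + 2)%N) ->
  (\sum_(e <- medges g) cost e <= 2 * mlength g)%N.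
Proof.
move=> mg sc; rewrite -(leq_add2l (\sum_(e <- medges g) s (gsrc e))).
rewrite -{1}(big_map (@gsrc G) xpredT s) -(perm_big _ (perm_medges mg)) /= big_map.
rewrite -big_split /= big_seq (leq_trans (leq_sum _ sc)) // -big_seq big_split /=.
by rewrite big_const_seq count_predT iter_addn_0 size_medges.
Qed.

Section Edges.
Variable Phi : Sigma -> label.
Hypothesis Phi_lt : forall v, Phi v <> LE -> (vi v < vj v)%N.

Definition low (e : GEdge Phi) : bool :=
  if Phi (Gsrc e) is LS then ~~ (val e).2 else false.

Lemma edge_lt (e : GEdge Phi) : (vi (Gsrc e) < vj (Gsrc e))%N.
Proof. by apply: Phi_lt => PE; have := valP e; rewrite /edge_ok -/(Gsrc e) PE. Qed.

Lemma low_det (e f : GEdge Phi) : low e = low f -> Gsrc e = Gsrc f -> e = f.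
Proof.
move=> + ef; have := valP e; have := valP f.
rewrite /low /edge_ok -!/(Gsrc _) -ef => ok1 ok2 lef; apply: val_inj.
rewrite (surjective_pairing (val e)) [RHS]surjective_pairing; congr pair => //.
by move: ok1 ok2 lef; case: (Phi _) => //; case: (val e).2; case: (val f).2.
Qed.

Lemma low_tgt (e : GEdge Phi) : low e -> Gtgt e = mkS 1 (vi (Gsrc e)).+1.
Proof. by rewrite /low /Gtgt -/(Gsrc e); case: (Phi _) => // /negbTE ->. Qed.

Lemma nlow_tgt (e : GEdge Phi) : ~~ low e ->
  exists2 i, Gtgt e = mkS i (vj (Gsrc e)).+1 & (0 < i <= (vi (Gsrc e)).+1)%N.
Proof.
have := valP e; rewrite /low /Gtgt /edge_ok -/(Gsrc e).
case: (Phi _) => // ok; first by exists (vi (Gsrc e)).+1; rewrite ?leqnn.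
by move/negPn => ->; exists 1%N.
Qed.

Lemma nlow_vj (e : GEdge Phi) : ~~ low e -> vj (Gtgt e) = (vj (Gsrc e)).+1.
Proof. by move=> /nlow_tgt[i -> ii]; have lt_e := edge_lt e; rewrite vjE //; lia. Qed.

Lemma low_vj (e : GEdge Phi) : low e -> vj (Gtgt e) = (vi (Gsrc e)).+1.
Proof. by move=> /low_tgt ->; rewrite vjE. Qed.

(** A low edge goes from (a,b) to (1,a+1), whose coordinate sum is a+2 = (a+b+2) - b; any other edge
    adds at most 1 to each coordinate. *)
Lemma tgt_cost (e : GEdge Phi) :
  (vi (Gtgt e) + vj (Gtgt e) + (if low e then vj (Gsrc e) else 0)
   <= vi (Gsrc e) + vj (Gsrc e) + 2)%N.
Proof.
have lt_e := edge_lt e; case: ifPn => [/low_tgt ->|/nlow_tgt[i -> ii]].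
  by rewrite viE ?vjE //; lia.
by rewrite viE ?vjE; lia.
Qed.
End Edges.
Arguments low {Phi} e.

(** Used to compare [Gamma] with its folding: they have the same edges and sources, and may differ
    only in targets. *)
Lemma simple_cycle_retarget (V E : choiceType) (s t t' : E -> V) (S : {fset E}) :
  (forall e, e \in S -> t e = t' e) ->
  @simple_cycle (MGraph s t) S -> @simple_cycle (MGraph s t') S.
Proof.
move=> tt [c [c0 uc cc SE]]; exists c; split=> //.
have cP : all [in c] c by apply/allP.
have tE : {in [in c] &, @follows (MGraph s t') =2 @follows (MGraph s t)}.
  by move=> e f ec _; rewrite /follows /= tt // SE !inE.
by rewrite (eq_in_cycle tE cP).
Qed.

Lemma multicycle_retarget (V E : choiceType) (s t t' : E -> V) (g : {fset {fset E}}) :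
  (forall e, e \in @medges (MGraph s t) g -> t e = t' e) ->
  @multicycle (MGraph s t) g -> @multicycle (MGraph s t') g.
Proof.
move=> tt [cg dg]; split=> [S Sg|S T]; last exact: dg.
apply: simple_cycle_retarget (cg S Sg) => e eS; apply: tt.
by apply/(@mem_medges (MGraph s t)); exists S.
Qed.

(** * Multicycles of the folded graph *)

Section Count.
Variables (Phi : Sigma -> label) (M q : nat).
Hypothesis M0 : (0 < M)%N.
Hypothesis Phi_lt : forall v, Phi v <> LE -> (vi v < vj v)%N.
Local Notation B := (q + M)%N.
Local Notation G := (foldedG Phi (red M q)).
Implicit Types (e f : GEdge Phi) (g h : {fset {fset GEdge Phi}}).

Definition wrap e := ~~ low e && (vj (Gsrc e) == B).
Definition special e := low e || wrap e.

Definition edge_cost e := if low e then vj (Gsrc e) else if wrap e then M else 0%N.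

Lemma red_tgt_low e : low e -> (vj (Gsrc e) <= B)%N -> red M q (Gtgt e) = Gtgt e.
Proof.
move=> le eB; apply: red_id => //; rewrite low_vj //.
exact: leq_trans (edge_lt Phi_lt e) eB.
Qed.

Lemma red_tgt_nspecial e : ~~ special e -> (vj (Gsrc e) <= B)%N ->
  red M q (Gtgt e) = Gtgt e.
Proof.
rewrite /special /wrap negb_or => /andP[nle]; rewrite nle /= => eB eB'.
by apply: red_id => //; rewrite nlow_vj //; lia.
Qed.

Lemma red_tgt_cost e : (vj (Gsrc e) <= B)%N ->
  (vi (red M q (Gtgt e)) + vj (red M q (Gtgt e)) + edge_cost e
   <= vi (Gsrc e) + vj (Gsrc e) + 2)%N.
Proof.
move=> eB; have := tgt_cost Phi_lt e; rewrite /edge_cost.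
have [le|nle] := boolP (low e); first by rewrite red_tgt_low.
have [we _|nwe] := boolP (wrap e); last first.
  by rewrite red_tgt_nspecial // /special (negbTE nle) (negbTE nwe).
rewrite vi_red ?vj_red //; have [i -> ii] := nlow_tgt nle.
have lt_e := edge_lt Phi_lt e; move: we; rewrite /wrap nle => /eqP eB'.
rewrite viE ?vjE; [|lia..].
(* The smaller coordinate stays in range, while q+M+1 folds to q+1; this drop is exactly the cost
   [M]. *)
by rewrite eB' fold_wrap // fold_id; lia.
Qed.

(** Each source is also a target, and all targets are reduced. *)
Lemma medges_src_le g e : @multicycle G g -> e \in @medges G g -> (vj (Gsrc e) <= B)%N.
Proof.
move=> mg eg; have : Gsrc e \in map (@gsrc G) (@medges G g) by exact: (map_f (@gsrc G)).
by rewrite -(perm_mem (perm_medges mg)) => /mapP[f _ ->]; apply: red_le.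
Qed.

Lemma sum_edge_cost g : @multicycle G g ->
  (\sum_(e <- @medges G g) edge_cost e <= 2 * @mlength G g)%N.
Proof.
move=> mg; apply: (@mlength_cost G (fun v => vi v + vj v)%N) => // e eg.
exact/red_tgt_cost/(medges_src_le mg eg).
Qed.

Lemma sum_low g : @multicycle G g ->
  (\sum_(e <- @medges G g | low e) vj (Gsrc e) <= 2 * @mlength G g)%N.
Proof.
move=> mg; apply: leq_trans (sum_edge_cost mg); rewrite big_mkcond.
by apply: leq_sum => e _; rewrite /edge_cost; case: ifP.
Qed.

Lemma count_wrap g : @multicycle G g ->
  (count wrap (@medges G g) * M <= 2 * @mlength G g)%N.
Proof.
move=> mg; apply: leq_trans (sum_edge_cost mg).
rewrite -sum1_count big_distrl /= big_mkcond; apply: leq_sum => e _.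
rewrite mul1n /edge_cost; case: ifPn => // we; rewrite ifF //.
by move: we; rewrite /wrap; case: low.
Qed.

Lemma low_le g e : @multicycle G g -> e \in @medges G g -> low e ->
  (vj (Gsrc e) <= 2 * @mlength G g)%N.
Proof.
move=> mg eg le; apply: leq_trans (sum_low mg).
by rewrite (perm_big _ (perm_to_rem eg)) big_cons le leq_addr.
Qed.

(* The targets (1, i+1) of the low edges of a multicycle are distinct, and
   their heights are bounded by those of the sources. *)
Lemma count_low g : @multicycle G g ->
  (count low (@medges G g) * (count low (@medges G g)).+1 <= 4 * @mlength G g)%N.
Proof.
move=> mg; pose s := [seq vi (Gsrc e) | e <- @medges G g & low e].
have us : uniq s.
  rewrite map_inj_in_uniq ?filter_uniq ?(map_uniq (uniq_medges mg)) //.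
  move=> e f; rewrite !mem_filter => /andP[le eg] /andP[lf fg] ef.
  have tef : @gtgt G e = @gtgt G f by rewrite /= low_tgt // ef -low_tgt.
  exact: medges_tgt_inj mg eg fg tef.
have := uniq_sum_ge us; rewrite size_map size_filter => /(_ _) cs.
apply: leq_trans (cs _) _.
  by move=> _ /mapP[e _ ->]; have /andP[] := SigmaP (Gsrc e).
rewrite (_ : 4 = 2 * 2)%N // -mulnA leq_mul2l /= big_map big_filter.
apply: leq_trans (sum_low mg); apply: leq_sum => e _.
exact: ltnW (edge_lt Phi_lt e).
Qed.

(** Otherwise every edge would raise the height [vj] by one, and the total height of the targets
    would exceed that of the sources by the length of the cycle. *)
Lemma special_cycle S : @simple_cycle G S -> exists2 e, e \in S & special e.
Proof.
move=> cS; apply/(@hasP _ special (enum_fset S)); apply: contraT => /hasPn nS.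
have [ps _] := simple_cycle_perm cS; have [e0 e0S] := simple_cycle_neq0 cS.
have SB e : e \in S -> (vj (Gsrc e) <= B)%N.
  move=> eS; have : Gsrc e \in map (@gsrc G) (enum_fset S) by exact: (map_f (@gsrc G)).
  by rewrite -(perm_mem ps) => /mapP[f _ ->]; apply: red_le.
have : (\sum_(v <- map (@gtgt G) (enum_fset S)) vj v = \sum_(v <- map (@gsrc G) (enum_fset S)) vj v)%N.
  exact: perm_big.
rewrite !big_map /=.
have -> : (\sum_(e <- S) vj (red M q (Gtgt e)) = \sum_(e <- S) (vj (Gsrc e) + 1))%N.
  rewrite big_seq [RHS]big_seq; apply: eq_bigr => e eS.
  rewrite red_tgt_nspecial ?nS ?SB // nlow_vj ?addn1 //.
  by have := nS e eS; rewrite negb_or => /andP[].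
rewrite big_split /= sum1_size => /eqP; rewrite -[X in _ == X]addn0 eqn_add2l.
by rewrite size_eq0 => /eqP S0; move: e0S; rewrite -[_ \in S]/(_ \in enum_fset S) S0.
Qed.

Lemma nspecial_det e f : ~~ special e -> ~~ special f -> Gsrc e = Gsrc f -> e = f.
Proof.
rewrite /special !negb_or => /andP[ne _] /andP[nf _].
by apply: low_det; rewrite (negbTE ne) (negbTE nf).
Qed.

Section Code.
Variable n : nat.
Local Notation N := (2 * n)%N.

(** By [low_le] the coordinates recorded here are at most 2n when [g] has length n, so [inord] loses
    nothing. *)
Definition low_code g : {set 'I_N.+1 * 'I_N.+1} :=
  [set x in [seq (inord (vi (Gsrc e)), inord (vj (Gsrc e))) | e <- @medges G g & low e]].
(** The source of a wrap has height [B], so its smaller coordinate suffices. *)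
Definition wrap_code g : {set 'I_B.+1} :=
  [set x in [seq inord (vi (Gsrc e)) | e <- @medges G g & wrap e]].

Lemma card_low_code g r : @multicycle G g -> @mlength G g = n ->
  (4 * n < r.+1 * r.+2)%N -> (#|low_code g| <= r)%N.
Proof.
move=> mg lg nr; rewrite cardsE; apply: leq_trans (card_size _) _.
rewrite size_map size_filter; have := count_low mg; rewrite lg => cl.
rewrite leqNgt; apply/negP => rc.
by have := leq_mul rc (rc : (r.+1 < _.+1)%N); rewrite leqNgt (leq_ltn_trans cl nr).
Qed.

Lemma card_wrap_code g : @multicycle G g -> @mlength G g = n ->
  (#|wrap_code g| <= N %/ M)%N.
Proof.
move=> mg lg; rewrite cardsE; apply: leq_trans (card_size _) _.
rewrite size_map size_filter leq_divRL //; have := count_wrap mg.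
by rewrite lg.
Qed.

Lemma low_code_inj g h e : @multicycle G g -> @mlength G g = n ->
  @multicycle G h -> @mlength G h = n -> low_code g = low_code h ->
  low e -> e \in @medges G g -> e \in @medges G h.
Proof.
move=> mg lg mh lh gh le eg.
have : (inord (vi (Gsrc e)), inord (vj (Gsrc e))) \in low_code g.
  rewrite inE; apply: (map_f (fun e => (inord (vi (Gsrc e)), inord (vj (Gsrc e))))).
  by rewrite mem_filter le.
rewrite gh inE => /mapP[f]; rewrite mem_filter => /andP[lf fh].
have := low_le mg eg le; have := low_le mh fh lf; rewrite lg lh => fN eN.
have lte := edge_lt Phi_lt e; have ltf := edge_lt Phi_lt f.
case=> /(congr1 val) + /(congr1 val); rewrite /= !inordK; try lia.
move=> ei ej; suff -> : e = f by [].
by apply: low_det; [rewrite le lf | apply: Sigma_eq].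
Qed.

Lemma wrap_code_inj g h e : @multicycle G g -> @multicycle G h ->
  wrap_code g = wrap_code h ->
  wrap e -> e \in @medges G g -> e \in @medges G h.
Proof.
move=> mg mh gh we eg.
have : inord (vi (Gsrc e)) \in wrap_code g.
  by rewrite inE; apply: (map_f (fun e => inord (vi (Gsrc e)))); rewrite mem_filter we.
rewrite gh inE => /mapP[f]; rewrite mem_filter => /andP[wf fh].
have lte := edge_lt Phi_lt e; have ltf := edge_lt Phi_lt f.
move: we wf; rewrite /wrap => /andP[le /eqP eB] /andP[lf /eqP fB].
move=> /(congr1 val); rewrite /= !inordK; try lia.
move=> ei; suff -> : e = f by [].
apply: low_det; first by rewrite (negbTE le) (negbTE lf).
by apply: Sigma_eq; rewrite // eB fB.
Qed.

Lemma norm_sd_coef_folded (R : realType) r : (4 * n < r.+1 * r.+2)%N ->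
  `|sd_coef G R n| <= (((N.+1 ^ 2).+1 ^ r) * (B.+2 ^ (N %/ M)))%:R.
Proof.
move=> nr; pose P1 := [set A : {set 'I_N.+1 * 'I_N.+1} | (#|A| <= r)%N]%SET.
pose P2 := [set A : {set 'I_B.+1} | (#|A| <= N %/ M)%N]%SET.
apply: (@le_trans _ _ (#|finset.setX P1 P2|%:R)).
  apply: (@norm_sd_coef_le G R n _ (finset.setX P1 P2) (fun g => (low_code g, wrap_code g))).
    by move=> g mg lg; rewrite !inE /= card_low_code // card_wrap_code.
  move=> g h mg lg mh lh [gh1 gh2].
  apply: (multicycle_eq_special special_cycle nspecial_det) => // e.
  by case/orP=> se; apply/idP/idP;
    [apply: low_code_inj | apply: low_code_inj
    | apply: wrap_code_inj | apply: wrap_code_inj].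
rewrite ler_nat cardsX; apply: leq_mul.
  by have := card_small_sets ('I_N.+1 * 'I_N.+1)%type r; rewrite card_prod !card_ord mulnn.
by have := card_small_sets 'I_B.+1 (N %/ M); rewrite card_ord.
Qed.

End Code.

(** The sources of a multicycle are distinct points of the square [0, B]^2, so its length is bounded
    and the determinant is a polynomial. *)
Lemma sd_coef_folded_large (R : realType) n : (B.+1 ^ 2 < n)%N -> sd_coef G R n = 0.
Proof.
move=> nB; apply: sd_coef_eq0 => g mg lg; move: nB; rewrite -lg ltnNge => /negP; apply.
pose pr (v : Sigma) := (vi v, vj v).
have pr_inj : injective pr by move=> v w [vw vw']; apply: Sigma_eq.
rewrite -size_medges -(size_map (@gsrc G)) -(size_map pr).
have -> : (B.+1 ^ 2 = size [seq (x, y) | x <- iota 0 B.+1, y <- iota 0 B.+1])%N.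
  by rewrite size_allpairs !size_iota mulnn.
apply: uniq_leq_size; first by rewrite map_inj_uniq //; exact: uniq_medges mg.
move=> _ /mapP[_ /mapP[e eg ->] ->]; have eB := medges_src_le mg eg.
have lte := edge_lt Phi_lt e.
by apply: allpairs_f; rewrite mem_iota /= add0n; lia.
Qed.

(* In Gamma itself the edge leaving a highest vertex of a multicycle is low,
   so its height is at most 2n. *)
Lemma medges_Gamma_le g e : @multicycle (Gamma Phi) g -> e \in @medges (Gamma Phi) g ->
  (vj (Gsrc e) <= 2 * @mlength (Gamma Phi) g)%N.
Proof.
move=> mg eg.
have [e0 e0g e0max] : exists2 e0, e0 \in @medges (Gamma Phi) g &
    forall f, f \in @medges (Gamma Phi) g -> (vj (Gsrc f) <= vj (Gsrc e0))%N.
  case: (@medges (Gamma Phi) g) eg => // x s _.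
  exact: (exists_max_seq (fun e => vj (Gsrc e))).
apply: leq_trans (e0max e eg) _.
have [f fg /eqP ef] := medges_next mg e0g.
have le0 : low e0.
  apply: contraT => /(nlow_vj Phi_lt) ve0; have := e0max f fg.
  by rewrite -[Gsrc f]/(@gsrc (Gamma Phi) f) -ef /= ve0 ltnn.
apply: leq_trans (@mlength_cost (Gamma Phi) (fun v => vi v + vj v)%N
  (fun e => if low e then vj (Gsrc e) else 0%N) g mg (fun e _ => tgt_cost Phi_lt e)).
by rewrite (perm_big _ (perm_to_rem e0g)) big_cons le0 leq_addr.
Qed.

Lemma sd_coef_folded_small (R : realType) n : (2 * n < M)%N ->
  sd_coef G R n = sd_coef (Gamma Phi) R n.
Proof.
move=> nM; apply: eq_fsbigl; apply/seteqP; split=> g [mg lg]; split=> //.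
- apply: (@multicycle_retarget _ _ (@Gsrc Phi) (fun e => red M q (Gtgt e)) (@Gtgt Phi) g _ mg) => e eg.
  have eB := medges_src_le mg eg.
  have [le|nle] := boolP (low e); first exact: red_tgt_low.
  apply: red_tgt_nspecial => //; rewrite /special (negbTE nle) /=.
  have := count_wrap mg; rewrite lg => cw.
  have : ~~ has wrap (@medges G g) by rewrite has_count -leqNgt; nia.
  by move/hasPn/(_ e eg).
- apply: (@multicycle_retarget _ _ (@Gsrc Phi) (@Gtgt Phi) (fun e => red M q (Gtgt e)) g _ mg) => e eg.
  have [f fg /eqP ef] := medges_next mg eg.
  (* The target of [e] is the source of the next edge, of height at most 2n < M, so folding fixes
     it. *)
  apply/esym/red_id => //; rewrite -[Gtgt e]/(@gtgt (Gamma Phi) e) ef /=.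
  by have := medges_Gamma_le mg fg; rewrite lg; lia.
Qed.

End Count.

(** * Complex polynomials *)

Section ComplexAbs.
Variable R : realType.
Implicit Types (x y z : R[i]).

(** The norm of [R[i]] takes values in [R[i]]; this real-valued modulus gives access to real
    arithmetic. *)
Definition cabs x : R := complex.Re `|x|.

Lemma normE x : `|x| = ((cabs x)%:C)%C.
Proof. by rewrite /cabs normc_def /=. Qed.

Lemma cabs_ge0 x : 0 <= cabs x.
Proof. by rewrite /cabs normc_def /= sqrtr_ge0. Qed.

Lemma cabsM x y : cabs (x * y) = cabs x * cabs y.
Proof. by apply: complexI; rewrite -normE normrM !normE rmorphM. Qed.

Lemma cabsD x y : cabs (x + y) <= cabs x + cabs y.
Proof. by rewrite -lecR rmorphD /= -!normE; apply: ler_normD. Qed.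

Lemma cabsN x : cabs (- x) = cabs x.
Proof. by rewrite /cabs normrN. Qed.

Lemma cabsB x y : cabs (x - y) = cabs (y - x).
Proof. by rewrite -cabsN opprB. Qed.

Lemma cabs0 : cabs 0 = 0.
Proof. by rewrite /cabs normr0. Qed.

Lemma cabs1 : cabs 1 = 1.
Proof. by rewrite /cabs normr1. Qed.

Lemma cabs_eq0 x : (cabs x == 0) = (x == 0).
Proof. by rewrite -[RHS]normr_eq0 normE -(inj_eq (@complexI R)). Qed.

Lemma cabsX x n : cabs (x ^+ n) = cabs x ^+ n.
Proof. by elim: n => [|n IHn]; rewrite ?cabs1 // !exprS cabsM IHn. Qed.

Lemma cabs_real (a : R) : cabs (a%:C)%C = `|a|.
Proof.
by rewrite /cabs normc_def /= expr0n addr0 sqrtr_sqr.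
Qed.

Lemma cabs_nat n : cabs n%:R = n%:R.
Proof. by rewrite -(rmorph_nat (real_complex R)) cabs_real normr_nat. Qed.

Lemma cabs_conj x : cabs (x^*)%C = cabs x.
Proof. by rewrite /cabs normcJ. Qed.

Lemma mul_conj x : x * (x^*)%C = ((cabs x ^+ 2)%:C)%C.
Proof. by rewrite -sqr_normc normE rmorphXn. Qed.

Lemma cabs_sum (I : Type) (s : seq I) (P : pred I) (F : I -> R[i]) :
  cabs (\sum_(i <- s | P i) F i) <= \sum_(i <- s | P i) cabs (F i).
Proof.
elim/big_ind2: _ => //; first by rewrite cabs0.
by move=> a b c d ab cd; apply: le_trans (cabsD _ _) (lerD ab cd).
Qed.

Lemma cabs_prod (I : Type) (s : seq I) (P : pred I) (F : I -> R[i]) :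
  cabs (\prod_(i <- s | P i) F i) = \prod_(i <- s | P i) cabs (F i).
Proof. by elim/big_ind2: _ => //; [exact: cabs1|move=> a a' b b' <- <-; exact: cabsM]. Qed.

Lemma cabs_subD x y : cabs x - cabs y <= cabs (x + y).
Proof. by have := cabsD (x + y) (- y); rewrite addrK cabsN lerBlDr. Qed.

Lemma ltr_cabs x (a : R) : (`|x| < (a%:C)%C) = (cabs x < a).
Proof. by rewrite normE ltcR. Qed.

End ComplexAbs.

Section RealFacts.
Variable R : realType.

Lemma bernoulli (a : R) n : 0 <= a -> 1 + n%:R * a <= (1 + a) ^+ n.
Proof.
move=> a0; elim: n => [|n IHn]; first by rewrite expr0 mul0r addr0.
rewrite exprS; apply: (@le_trans _ _ ((1 + a) * (1 + n%:R * a))).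
  rewrite -natr1; have := mulr_ge0 (ler0n R n) (mulr_ge0 a0 a0); lra.
by rewrite ler_wpM2l //; lra.
Qed.

Lemma exp_unbounded (x K : R) : 1 < x -> exists n, K < x ^+ n.
Proof.
move=> x1; have K0 : 0 <= `|K| / (x - 1) by apply: divr_ge0 => //; lra.
exists (Num.Def.archi_bound (`|K| / (x - 1))).
have := archi_boundP K0; set n := Num.Def.archi_bound _ => nK.
have := @bernoulli (x - 1) n; rewrite [1 + (x - 1)]addrC subrK => b.
apply: lt_le_trans (b _); last lra.
move: nK; rewrite ltr_pdivrMr; last lra.
by have := ler_norm K; lra.
Qed.

Lemma exp_null (x e : R) : 0 <= x < 1 -> 0 < e -> exists n, x ^+ n < e.
Proof.
case/andP; rewrite le_eqVlt => /predU1P[<- _ e0|x0 x1 e0].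
  by exists 1%N; rewrite expr1.
have xi : 1 < x^-1 by rewrite invf_gt1.
have [n] := exp_unbounded e^-1 xi.
by rewrite exprVn ltf_pV2 ?posrE ?exprn_gt0 //; exists n.
Qed.

Lemma sum_half n : \sum_(i < n) (2^-1 : R) ^+ i <= 2.
Proof.
suff -> : \sum_(i < n) (2^-1 : R) ^+ i = 2 - 2 * 2^-1 ^+ n.
  by rewrite gerBl mulr_ge0 ?exprn_ge0.
elim: n => [|n IHn]; first by rewrite big_ord0 expr0; lra.
by rewrite big_ord_recr /= IHn exprS; field.
Qed.

End RealFacts.

Section Poly.
Variable R : realType.
Implicit Types (p : {poly R[i]}) (r m : R) (x z : R[i]).

Lemma horner_cabs_le p x : cabs p.[x] <= \sum_(i < size p) cabs p`_i * cabs x ^+ i.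
Proof.
rewrite horner_coef; apply: le_trans (cabs_sum _ _ _) _.
by apply: ler_sum => i _; rewrite cabsM cabsX.
Qed.

Lemma XnsubC_roots (n : nat) (c : R[i]) : (0 < n)%N ->
  exists2 s : seq R[i], 'X^n - c%:P = \prod_(x <- s) ('X - x%:P) & size s = n.
Proof.
move=> n0; have [s ps] := closed_field_poly_normal ('X^n - c%:P).
rewrite (monicP _) ?monicXnsubC // scale1r in ps.
exists s => //; apply: succn_inj.
by rewrite -(size_prod_XsubC s id) -ps size_XnsubC.
Qed.

(* With x ranging over the roots of X^N - r^N, the product of the p(x) is, up
   to sign, lc(p)^N times the product of the a^N - r^N over the roots a of p. *)
Lemma min_principle_pow p r m (N : nat) : 0 < r -> 0 <= m -> (0 < N)%N ->
  (forall x, cabs x = r -> m <= cabs p.[x]) ->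
  (forall x, root p x -> r < cabs x) ->
  m ^+ N <= 2 ^+ (size p) * cabs p.[0] ^+ N.
Proof.
move=> r0 m0 N0 mp rp.
have [pE|p0] := eqVneq p 0.
  have m0' : m <= 0.
    by have := mp (r%:C)%C; rewrite pE !horner0 cabs0 cabs_real gtr0_norm //; apply.
  have -> : m = 0 by apply/eqP; rewrite eq_le m0 m0'.
  by rewrite pE horner0 cabs0 !expr0n (gtn_eqF N0) /= mulr0.
have [zs pz] := closed_field_poly_normal p.
have lc0 : lead_coef p != 0 by rewrite lead_coef_eq0.
have rz z : z \in zs -> r < cabs z.
  by move=> zz; apply: rp; rewrite pz rootZ // root_prod_XsubC.
have szp : size p = (size zs).+1 by rewrite pz size_scale // size_prod_XsubC.
have [xs xsE sxs] := @XnsubC_roots N ((r ^+ N)%:C)%C N0.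
have rx x : x \in xs -> cabs x = r.
  rewrite -root_prod_XsubC -xsE /root !hornerE subr_eq0 => /eqP xN.
  apply/eqP; rewrite -(@eqrXn2 _ N) ?cabs_ge0 ?ltW // -cabsX xN cabs_real.
  by rewrite ger0_norm // exprn_ge0 // ltW.
have hE y : p.[y] = lead_coef p * \prod_(z <- zs) (y - z).
  by rewrite {1}pz hornerZ horner_prod; congr (_ * _); apply: eq_bigr => z _; rewrite !hornerE.
have -> : m ^+ N = \prod_(x <- xs) m by rewrite big_const_seq count_predT iter_mulr_1 sxs.
apply: (@le_trans _ _ (\prod_(x <- xs) cabs p.[x])).
  rewrite big_seq [leRHS]big_seq; apply: ler_prod => x xx.
  by rewrite m0 mp // rx.
have -> : \prod_(x <- xs) cabs p.[x] =
   cabs (lead_coef p) ^+ N * \prod_(z <- zs) cabs (z ^+ N - ((r ^+ N)%:C)%C).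
  under eq_bigr do rewrite hE cabsM cabs_prod.
  rewrite big_split /= big_const_seq count_predT iter_mulr_1 sxs; congr (_ * _).
  rewrite exchange_big /=; apply: eq_bigr => z _.
  have -> : z ^+ N - ((r ^+ N)%:C)%C = ('X^N - ((r ^+ N)%:C)%C%:P).[z] by rewrite !hornerE.
  rewrite xsE horner_prod cabs_prod; apply: eq_bigr => x _.
  by rewrite !hornerE cabsB.
(* The leading coefficient cancels. Each root has modulus greater than [r], so |z^N - r^N| <= 2
   |z|^N; this costs one factor 2 per root. *)
rewrite hE cabsM exprMn mulrCA ler_wpM2l ?exprn_ge0 ?cabs_ge0 //.
rewrite cabs_prod -prodrXl szp.
have -> : (2 : R) ^+ (size zs).+1 * \prod_(z <- zs) cabs (0 - z) ^+ N =
    2 * \prod_(z <- zs) (2 * cabs z ^+ N).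
  rewrite big_split /= big_const_seq count_predT iter_mulr_1 exprS -mulrA; congr (_ * (_ * _)).
  by apply: eq_bigr => z _; rewrite sub0r cabsN.
have P0 : 0 <= \prod_(z <- zs) (2 * cabs z ^+ N).
  by apply: prodr_ge0 => z _; rewrite mulr_ge0 // exprn_ge0 // cabs_ge0.
apply: le_trans (_ : \prod_(z <- zs) (2 * cabs z ^+ N) <= _); last by lra.
rewrite big_seq [leRHS]big_seq; apply: ler_prod => z zz; rewrite cabs_ge0 /=.
apply: le_trans (cabsD _ _) _; rewrite cabsN cabsX cabs_real ger0_norm ?exprn_ge0 ?(ltW r0) //.
have : r ^+ N <= cabs z ^+ N by rewrite lerXn2r ?nnegrE ?cabs_ge0 ?(ltW r0) // ltW // rz.
by lra.
Qed.

(** If [m] exceeded |p(0)|, the powers of their ratio would be unbounded, whereas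
    [min_principle_pow] bounds them by [2 ^+ size p]. *)
Lemma min_principle p r m : 0 < r ->
  (forall x, cabs x = r -> m <= cabs p.[x]) ->
  (forall x, root p x -> r < cabs x) ->
  m <= cabs p.[0].
Proof.
move=> r0 mp rp; rewrite leNgt; apply/negP => pm.
have p00 : 0 < cabs p.[0].
  rewrite lt_neqAle cabs_ge0 andbT eq_sym cabs_eq0; apply/negP => /rp.
  by rewrite cabs0; lra.
have m0 : 0 < m by lra.
have mc : 1 < m / cabs p.[0] by rewrite ltr_pdivlMr // mul1r.
have [n] := exp_unbounded (2 ^+ size p) mc; case: n => [|n].
  by rewrite expr0 ltNge exprn_ege1 //; lra.
rewrite expr_div_n ltr_pdivlMr ?exprn_gt0 // ltNge.
by rewrite (min_principle_pow r0 (ltW m0)).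
Qed.

Lemma prim_root_exists (n : nat) : (0 < n)%N -> exists w : R[i], n.-primitive_root w.
Proof.
move=> n0; have [s sE ss] := @XnsubC_roots n 1 n0.
have rn1 : all n.-unity_root s.
  by apply/allP=> x; rewrite -root_prod_XsubC -sE rmorph1.
have us : uniq s.
  by rewrite -separable_prod_XsubC -sE rmorph1 separable_Xn_sub_1 // pnatr_eq0 -lt0n.
by have := has_prim_root n0 rn1 us; rewrite ss => /(_ (leqnn n))/hasP[w _ pw]; exists w.
Qed.

Lemma prim_root_sum (n k : nat) (w : R[i]) : n.-primitive_root w ->
  \sum_(i < n) (w ^+ k) ^+ i = if (n %| k)%N then n%:R else 0.
Proof.
move=> pw; rewrite (prim_order_dvd pw); case: eqVneq => [->|wk].
  by under eq_bigr do rewrite expr1n; rewrite sumr_const card_ord.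
have := subrX1 (w ^+ k) n; rewrite -exprM mulnC exprM (prim_expr_order pw) expr1n subrr.
by move/esym/eqP; rewrite mulf_eq0 subr_eq0 (negbTE wk) => /eqP.
Qed.
Lemma cauchy_coef p r m (j : nat) : 0 <= r ->
  (forall x, cabs x = r -> cabs p.[x] <= m) -> cabs p`_j * r ^+ j <= m.
Proof.
(* With this many sample points the average isolates coefficient [j]: for k < N, the number k+N-j is
   a multiple of N only if k = j. The exponent N-j stands for -j. *)
move=> r0 pm; pose N := (size p + j).+1.
have [w pw] := @prim_root_exists N isT.
have w1 : cabs w = 1.
  apply/eqP; rewrite -(@eqrXn2 _ N) ?cabs_ge0 // -cabsX (prim_expr_order pw).
  by rewrite cabs1 expr1n.
pose x i : R[i] := (r%:C)%C * w ^+ i.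
have xr i : cabs (x i) = r by rewrite cabsM cabsX w1 expr1n mulr1 cabs_real ger0_norm.
have E : \sum_(i < N) p.[x i] * (w ^+ i) ^+ (N - j) = N%:R * ((r%:C)%C ^+ j * p`_j).
  have pS : (size p <= N)%N by rewrite /N; lia.
  under eq_bigr do rewrite (horner_coef_wide _ pS) mulr_suml.
  rewrite exchange_big /=.
  have jN : (j < N)%N by rewrite /N; lia.
  rewrite (bigD1 (Ordinal jN)) //= [X in _ + X]big1 ?addr0.
    under eq_bigr => i _.
      rewrite /x exprMn -mulrA -mulrA -exprD subnKC 1?ltnW // -exprM mulnC exprM.
      rewrite (prim_expr_order pw) expr1n mulr1.
      over.
    by rewrite sumr_const card_ord -[LHS]mulr_natl; congr (_ * _); rewrite mulrC.
  move=> k kj; have kN := ltn_ord k.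
  have -> : \sum_(i < N) p`_k * x i ^+ k * (w ^+ i) ^+ (N - j) =
      p`_k * (r%:C)%C ^+ k * \sum_(i < N) (w ^+ (k + (N - j))) ^+ i.
    rewrite big_distrr /=; apply: eq_bigr => i _.
    by rewrite /x exprMn mulrA -mulrA -exprD -!exprM [(_ * i)%N]mulnC.
  rewrite (prim_root_sum _ pw) ifF ?mulr0 //.
  apply/negP => /dvdnP[c kc]; have : c = 1%N by nia.
  by move=> c1; move/eqP: kj; apply; apply: val_inj => /=; lia.
have N0 : 0 < N%:R :> R by rewrite ltr0n.
rewrite -(ler_pM2l N0); have -> : N%:R * (cabs p`_j * r ^+ j) = cabs (N%:R * ((r%:C)%C ^+ j * p`_j)).
  by rewrite !cabsM cabs_nat cabsX cabs_real ger0_norm // [r ^+ j * _]mulrC.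
rewrite -E; apply: le_trans (cabs_sum _ _ _) _.
have -> : N%:R * m = \sum_(i < N) m by rewrite sumr_const card_ord mulr_natl.
by apply: ler_sum => i _; rewrite cabsM !cabsX w1 !expr1n mulr1 pm.
Qed.

End Poly.

(** * Hurwitz' theorem for a uniformly Cauchy sequence of polynomials; the limit function itself
    never appears *)

Section Hurwitz.
Variable R : realType.
Implicit Types (p : {poly R[i]}) (r m : R) (x z : R[i]).

Definition shift_poly p z := p \Po ('X + z%:P).

Lemma horner_shift p z x : (shift_poly p z).[x] = p.[x + z].
Proof. by rewrite /shift_poly horner_comp !hornerE. Qed.

(* If the Taylor polynomial A of p at z is small, then p = A + (w - z)^d Q.  On the
   circle |w| = rho the moduli |rho^2 - z^* w| and rho |w - z| agree, so the maximum
   principle for Q (rho^2 - z^* w)^d bounds Q(0), while p(0) = 1 bounds it below. *)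
Lemma taylor_small_bound p z (rho C : R) (d : nat) :
  0 < rho -> cabs z < rho -> p.[0] = 1 ->
  (forall w, cabs w <= rho -> cabs p.[w] <= C) ->
  \sum_(j < d) cabs (shift_poly p z)`_j * (2 * rho) ^+ j <= 2^-1 ->
  rho ^+ d <= (2 * C + 1) * cabs z ^+ d.
Proof.
move=> rho0 zrho p01 pC small; set t := shift_poly p z in small.
pose A := take_poly d t; pose Q := drop_poly d t.
have pE w : p.[w] = A.[w - z] + Q.[w - z] * (w - z) ^+ d.
  by rewrite -{1}[w](subrK z) -horner_shift -/t -{1}(poly_take_drop d t) !hornerE.
have z0 := cabs_ge0 z.
(* On the disk |w - z| <= 2 rho, which explains the radius in the smallness hypothesis. *)
have AS w : cabs w <= rho -> cabs A.[w - z] <= 2^-1.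
  move=> wr; apply: le_trans small.
  have sA : (size A <= d)%N by apply: size_take_poly.
  rewrite (horner_coef_wide _ sA); apply: le_trans (cabs_sum _ _ _) _.
  apply: ler_sum => i _; rewrite coef_take_poly ltn_ord cabsM cabsX.
  rewrite ler_wpM2l ?cabs_ge0 // lerXn2r ?nnegrE ?cabs_ge0 //; first lra.
  by apply: le_trans (cabsD _ _) _; rewrite cabsN; lra.
pose F := (Q \Po ('X - z%:P)) * (((rho ^+ 2)%:C)%C%:P - (z^*)%C *: 'X) ^+ d.
have FE w : F.[w] = Q.[w - z] * (((rho ^+ 2)%:C)%C - (z^*)%C * w) ^+ d.
  by rewrite /F !hornerE horner_comp !hornerE.
(* Writing rho^2 as w w^* makes the left side the modulus of w (w - z)^*. *)
have circ w : cabs w = rho -> cabs (((rho ^+ 2)%:C)%C - (z^*)%C * w) = rho * cabs (w - z).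
  move=> wr; rewrite -{1}wr -mul_conj mulrC -mulrBl cabsM wr mulrC.
  by rewrite -rmorphB /= cabs_conj.
have Fm w : cabs w = rho -> cabs F.[w] <= rho ^+ d * (C + 2^-1).
  move=> wr; rewrite FE cabsM cabsX circ // exprMn mulrCA ler_wpM2l ?exprn_ge0 ?(ltW rho0) //.
  rewrite -cabsX -cabsM (_ : Q.[_] * _ = p.[w] - A.[w - z]); last by rewrite pE [RHS]addrAC subrr [RHS]add0r.
  apply: le_trans (cabsD _ _) _; rewrite cabsN.
  by apply: lerD; [apply: pC | apply: AS]; rewrite wr.
(* Cauchy's estimate for the constant coefficient serves as the maximum principle at 0. *)
have F0 := cauchy_coef 0 (ltW rho0) Fm.
rewrite expr0 mulr1 -horner_coef0 FE sub0r mulr0 subr0 cabsM cabsX cabs_real in F0.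
rewrite ger0_norm ?exprn_ge0 ?(ltW rho0) // -exprM mulnC exprM expr2 mulrCA in F0.
rewrite ler_pM2l ?exprn_gt0 // in F0.
have Q0 : 2^-1 <= cabs Q.[- z] * cabs z ^+ d.
  have E0 : Q.[0 - z] * (0 - z) ^+ d = p.[0] - A.[0 - z] by rewrite pE [RHS]addrAC subrr [RHS]add0r.
  rewrite !sub0r p01 in E0; have -> : cabs z ^+ d = cabs ((- z) ^+ d) by rewrite cabsX cabsN.
  rewrite -cabsM E0; have := cabs_subD 1 (- A.[- z]); rewrite cabsN cabs1.
  have := AS 0; rewrite sub0r cabs0 => /(_ (ltW rho0)); lra.
have rd0 : 0 < rho ^+ d by rewrite exprn_gt0.
have zd0 : 0 <= cabs z ^+ d by rewrite exprn_ge0.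
have H1 : cabs Q.[- z] * cabs z ^+ d * rho ^+ d <= (C + 2^-1) * cabs z ^+ d.
  by rewrite mulrAC mulrC [leRHS]mulrC ler_wpM2l.
have H2 : 2^-1 * rho ^+ d <= cabs Q.[- z] * cabs z ^+ d * rho ^+ d by rewrite ler_wpM2r // ltW.
lra.
Qed.

Lemma exists_uniform_rank (P : nat -> nat -> Prop) (d : nat) :
  (forall j, (j < d)%N -> exists N, forall k, (N <= k)%N -> P j k) ->
  exists N, forall k, (N <= k)%N -> forall j, (j < d)%N -> P j k.
Proof.
elim: d => [|d IHd] H; first by exists 0%N.
have [|N1 H1] := IHd; first by move=> j jd; apply: H; lia.
have [N2 H2] := H d (leqnn _).
exists (maxn N1 N2) => k; rewrite geq_max => /andP[k1 k2] j.
by rewrite ltnS leq_eqVlt => /predU1P[->|]; [apply: H2 | apply: H1].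
Qed.

Variables (P_ : nat -> {poly R[i]}) (z : R[i]) (rho C : R) (N0 : nat).
Hypothesis zrho : cabs z < rho.
Hypothesis P0 : forall k, (N0 <= k)%N -> (P_ k).[0] = 1.
Hypothesis PC : forall k, (N0 <= k)%N -> forall w, cabs w <= rho -> cabs (P_ k).[w] <= C.
Hypothesis P_cauchy : forall e, 0 < e -> exists N, forall k l, (N <= k)%N -> (N <= l)%N ->
  forall w, cabs w <= rho -> cabs ((P_ k).[w] - (P_ l).[w]) <= e.
Hypothesis P_z : forall e, 0 < e -> exists N, forall k, (N <= k)%N -> cabs (P_ k).[z] < e.

Local Notation t k := (shift_poly (P_ k) z).
Local Notation R0 := (rho - cabs z).

Let R0_gt0 : 0 < R0. Proof. by rewrite subr_gt0. Qed.
Let rho_gt0 : 0 < rho. Proof. exact: le_lt_trans (cabs_ge0 z) zrho. Qed.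

Let in_disk x : cabs x = R0 -> cabs (x + z) <= rho.
Proof. by move=> xR; apply: le_trans (cabsD _ _) _; rewrite xR subrK. Qed.

Lemma taylor_coef_le k j : (N0 <= k)%N -> cabs (t k)`_j * R0 ^+ j <= C.
Proof.
move=> kN; apply: cauchy_coef; first exact: ltW.
by move=> x xR; rewrite horner_shift PC // in_disk.
Qed.

Lemma taylor_coef_cauchy j e : 0 < e -> exists N, forall k l, (N <= k)%N -> (N <= l)%N ->
  cabs ((t k)`_j - (t l)`_j) <= e.
Proof.
move=> e0; have [|N HN] := P_cauchy (e := e * R0 ^+ j).
  by rewrite mulr_gt0 // exprn_gt0.
exists N => k l kN lN; rewrite -(ler_pM2r (exprn_gt0 j R0_gt0)) -coefB.
apply: cauchy_coef; first exact: ltW.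
by move=> x xR; rewrite hornerD hornerN !horner_shift HN // in_disk.
Qed.

(** Says that the limit has vanishing [j]-th Taylor coefficient at [z]. *)
Definition taylor_null j := forall e, 0 < e -> exists N, forall k, (N <= k)%N ->
  cabs (t k)`_j <= e.

Lemma taylor_null_sum d r e : 0 <= r -> 0 < e -> (forall j, (j < d)%N -> taylor_null j) ->
  exists N, forall k, (N <= k)%N -> \sum_(j < d) cabs (t k)`_j * r ^+ j <= e.
Proof.
move=> r0 e0 nl; pose S := 1 + \sum_(j < d) r ^+ j.
have S0 : 0 < S by rewrite ltr_pwDl // sumr_ge0 // => i _; rewrite exprn_ge0.
have [|N HN] := @exists_uniform_rank (fun j k => cabs (t k)`_j <= e / S) d.
  by move=> j jd; apply: nl => //; rewrite divr_gt0.
exists N => k kN; apply: (@le_trans _ _ (\sum_(j < d) e / S * r ^+ j)).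
  by apply: ler_sum => j _; rewrite ler_wpM2r ?exprn_ge0 // HN.
rewrite -big_distrr /= mulrAC ler_pdivrMr // ler_wpM2l ?(ltW e0) // /S.
by rewrite lerDr ler01.
Qed.

(** Replaces the identity theorem: the normalization at 0 keeps the limit from vanishing to infinite
    order at [z]. *)
Lemma taylor_not_null : exists j, ~ taylor_null j.
Proof.
have rho0 := rho_gt0; apply: contrapT => /forallNP nn.
have nl j : taylor_null j by have := nn j => /contrapT.
have C0 : 0 <= 2 * C + 1.
  have := PC (leqnn N0) (w := 0); rewrite cabs0 => /(_ (ltW rho_gt0)).
  by rewrite P0 // cabs1; lra.
have zr : 0 <= cabs z / rho < 1.
  by rewrite divr_ge0 ?cabs_ge0 ?(ltW rho_gt0) //= ltr_pdivrMr // mul1r.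
have C1 : 0 < 2 * C + 2 by lra.
have C2 : 0 < (2 * C + 2)^-1 by rewrite invr_gt0.
(* For this [d], (2C+2) |z|^d < rho^d, against the bound (2C+1) |z|^d of [taylor_small_bound]. *)
have [d] := exp_null zr C2; rewrite expr_div_n ltr_pdivrMr ?exprn_gt0 // => dlt.
have r20 : 0 <= 2 * rho by lra.
have h0 : 0 < (2^-1 : R) by lra.
have [N HN] := taylor_null_sum r20 h0 (fun j (_ : (j < d)%N) => nl j).
have := taylor_small_bound rho_gt0 zrho (P0 (leq_maxl N0 N)) (PC (leq_maxl N0 N))
  (HN _ (leq_maxr N0 N)).
move: dlt; rewrite mulrC ltr_pdivlMr //.
have : 0 <= cabs z ^+ d by rewrite exprn_ge0 // cabs_ge0.
lra.
Qed.

(* Cauchy and not null, hence eventually bounded away from 0. *)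
Lemma taylor_lower j : ~ taylor_null j ->
  exists2 eta, 0 < eta & exists N, forall k, (N <= k)%N -> eta <= cabs (t k)`_j.
Proof.
move=> nj; have [e [e0 He]] : exists e, 0 < e /\ forall N, exists2 k, (N <= k)%N & e < cabs (t k)`_j.
  apply: contrapT => /forallNP H; apply: nj => e e0; have := H e.
  move=> /not_andP[//|/existsNP[N HN]]; exists N => k kN; rewrite leNgt; apply/negP => ek.
  by apply: HN; exists k.
have e20 : 0 < e / 2 by lra.
have [N HN] := taylor_coef_cauchy j e20; exists (e / 2) => //; exists N => k kN.
have [l lN el] := He N; have := HN l k lN kN.
have := cabsD ((t k)`_j) ((t l)`_j - (t k)`_j); rewrite addrC subrK; lra.
Qed.

(** Let [j0] be the order of vanishing of the limit at [z]. On a small circle around [z] the term of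
    degree [j0] dominates and keeps [P_ k] away from 0. Without a root inside, the minimum principle
    would carry this bound to the centre, where the values tend to 0. *)
Lemma hurwitz_poly e : 0 < e -> exists N, forall k, (N <= k)%N ->
  exists2 w, root (P_ k) w & cabs (w - z) < e.
Proof.
have R00 := R0_gt0; move=> e0; have [j0 nj0 min_j0] : exists2 j, ~ taylor_null j & forall i, (i < j)%N -> taylor_null i.
  have [j nj] := taylor_not_null.
  have exj : exists j, `[< ~ taylor_null j >] by exists j; apply/asboolP.
  case: (ex_minnP exj) => i /asboolP ni imin; exists i => // l li.
  by apply: contrapT => nl; have /imin := introT (asboolP _) nl; lia.
have [eta eta0 [N1 HN1]] := taylor_lower nj0.
(* Bounds the quotient of the Taylor tail by x^(j0+1) for |x| <= R0/2: Cauchy's estimates leave a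
   geometric series of ratio 1/2. *)
pose K := 2 * C / R0 ^+ j0.+1.
have Kp : 0 < `|K| + 1 by have := normr_ge0 K; lra.
(* The three bounds keep the root within [e] of [z], make the series above converge, and hold the
   tail to a quarter of the main term. *)
pose r := Num.min (e / 2) (Num.min (R0 / 2) (eta / (4 * (`|K| + 1)))).
have r0 : 0 < r by rewrite !lt_min !divr_gt0 //; lra.
have re : r < e by rewrite gt_min; apply/orP; left; lra.
have rR : r <= R0 / 2 by rewrite /r !ge_min lexx orbT.
have rK : r * K <= eta / 4.
  have h : r <= eta / (4 * (`|K| + 1)) by rewrite /r !ge_min lexx !orbT.
  move: h; rewrite ler_pdivlMr; last by lra.
  have : r * K <= r * `|K| by rewrite ler_wpM2l ?(ltW r0) // ler_norm.
  lra.
have rj0 : 0 < r ^+ j0 by rewrite exprn_gt0.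
(* The main term is at least 2m; the lower-order terms and the tail take away at most m/2 each. *)
pose m := eta * r ^+ j0 / 2.
have m0 : 0 < m by rewrite /m divr_gt0 ?mulr_gt0.
have m20 : 0 < m / 2 by lra.
have [N2 HN2] := taylor_null_sum (ltW r0) m20 min_j0.
have [N3 HN3] := P_z m0.
exists (maxn N0 (maxn N1 (maxn N2 N3))) => k; rewrite !geq_max => /and4P[k0 k1 k2 k3].
apply: contrapT => noroot.
have : m <= cabs (t k).[0]; last by rewrite horner_shift add0r; have := HN3 k k3; lra.
apply: (min_principle r0) => [x xr|x]; last first.
  rewrite /root horner_shift => xz; rewrite ltNge; apply/negP => xr.
  apply: noroot; exists (x + z) => //; rewrite addrK; lra.
have -> : (t k).[x] = (take_poly j0 (t k)).[x] +
    ((t k)`_j0 * x ^+ j0 + (drop_poly j0.+1 (t k)).[x] * x ^+ j0.+1).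
  rewrite -{1}(poly_take_drop j0.+1 (t k)) hornerD hornerM hornerXn addrA; congr (_ + _).
  rewrite (horner_coef_wide _ (size_take_poly _ _)) big_ord_recr /= coef_take_poly leqnn.
  congr (_ + _); rewrite (horner_coef_wide _ (size_take_poly _ _)); apply: eq_bigr => i _.
  by rewrite !coef_take_poly ltn_ord ltnW // ltnS ltn_ord.
have A1 : cabs (take_poly j0 (t k)).[x] <= m / 2.
  apply: le_trans (HN2 k k2); rewrite (horner_coef_wide _ (size_take_poly _ _)).
  apply: le_trans (cabs_sum _ _ _) _; apply: ler_sum => i _.
  by rewrite coef_take_poly ltn_ord cabsM cabsX xr.
have A2 : eta * r ^+ j0 <= cabs ((t k)`_j0 * x ^+ j0).
  by rewrite cabsM cabsX xr ler_wpM2r ?(ltW rj0) // HN1.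
have A3 : cabs ((drop_poly j0.+1 (t k)).[x] * x ^+ j0.+1) <= m / 2.
  rewrite cabsM cabsX xr.
  have dK : cabs (drop_poly j0.+1 (t k)).[x] <= K.
    apply: le_trans (horner_cabs_le _ _) _; rewrite xr.
    have R0j : 0 < R0 ^+ j0.+1 by rewrite exprn_gt0.
    have C0 : 0 <= C by apply: le_trans (taylor_coef_le 0 k0); rewrite mulr_ge0 ?cabs_ge0 // expr0.
    apply: (@le_trans _ _ (C / R0 ^+ j0.+1 * \sum_(i < size (drop_poly j0.+1 (t k))) 2^-1 ^+ i)).
      rewrite big_distrr /=; apply: ler_sum => i _; rewrite coef_drop_poly.
      have Ri : 0 < R0 ^+ i by rewrite exprn_gt0.
      have := taylor_coef_le (i + j0.+1) k0; rewrite exprD => cf.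
      have ri : r ^+ i <= (R0 * 2^-1) ^+ i.
        apply: lerXn2r; rewrite ?nnegrE; [exact: ltW | | exact: rR].
        by rewrite mulr_ge0 ?invr_ge0 // ltW.
      apply: (@le_trans _ _ (cabs (t k)`_(i + j0.+1) * (R0 * 2^-1) ^+ i)).
        by rewrite ler_wpM2l ?cabs_ge0.
      rewrite exprMn mulrA ler_wpM2r ?exprn_ge0 ?invr_ge0 //.
      by rewrite ler_pdivlMr // -mulrA.
    rewrite (_ : K = C / R0 ^+ j0.+1 * 2); last by rewrite /K -mulrA mulrC.
    rewrite ler_wpM2l ?sum_half //.
    by rewrite divr_ge0 // ltW.
  rewrite exprS mulrA.
  apply: (@le_trans _ _ (eta / 4 * r ^+ j0)); last by rewrite /m; lra.
  rewrite ler_wpM2r ?(ltW rj0) //; apply: le_trans rK.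
  by rewrite mulrC ler_wpM2l // ltW.
have B1 := cabs_subD ((t k)`_j0 * x ^+ j0) ((drop_poly j0.+1 (t k)).[x] * x ^+ j0.+1).
have B2 := cabs_subD ((t k)`_j0 * x ^+ j0 + (drop_poly j0.+1 (t k)).[x] * x ^+ j0.+1)
  (take_poly j0 (t k)).[x].
rewrite [_ + (take_poly _ _).[x]]addrC in B2.
rewrite /m; move: A1 A2 A3 B1 B2; rewrite /m; lra.
Qed.

End Hurwitz.

(** * Growth and convergence *)

Section Growth.
Variable R : realType.

Lemma root_gt1 (x : R) (K : nat) : 1 < x -> exists2 y : R, 1 < y & y ^+ K.+1 = x.
Proof.
move=> x1; exists (expR (ln x / K.+1%:R)); first by rewrite expR_gt1 divr_gt0 ?ln_gt0.
by rewrite -expRM_natl mulrCA divff // mulr1 lnK // posrE; lra.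
Qed.

(** With x = y^(K+1) and y = 1+a, Bernoulli's inequality gives x^n >= (na)^(K+1), one degree more
    than the left side. *)
Lemma exp_beats_poly (x : R) (K c : nat) : 1 < x ->
  exists N, forall n, (N <= n)%N -> (n + c)%:R ^+ K <= x ^+ n.
Proof.
move=> x1; have [y y1 <-] := root_gt1 K x1; pose a := y - 1.
have a0 : 0 < a by rewrite /a; lra.
(* For n >= B the spare factor na absorbs ((1+c)/a)^K. *)
pose B := ((1 + c%:R) / a) ^+ K / a.
have c0 : 0 <= 1 + c%:R :> R by rewrite addr_ge0.
have B0 : 0 <= B by rewrite /B divr_ge0 ?(ltW a0) // exprn_ge0 // divr_ge0 // ltW.
exists (Num.Def.archi_bound B).+1 => n nB.
have n1 : 1 <= n%:R :> R by rewrite ler1n; lia.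
have nB' : B <= n%:R.
  by apply: ltW; apply: lt_le_trans (archi_boundP B0) _; rewrite ler_nat ltnW.
have yn : n%:R * a <= y ^+ n.
  have := @bernoulli R a n (ltW a0); rewrite (_ : 1 + a = y); last by rewrite /a; lra.
  by lra.
have na0 : 0 <= n%:R * a by rewrite mulr_ge0 // ltW.
rewrite -exprM mulnC exprM; apply: (@le_trans _ _ ((n%:R * a) ^+ K.+1)); last first.
  by rewrite lerXn2r ?nnegrE //; apply: le_trans yn.
apply: (@le_trans _ _ ((n%:R * (1 + c%:R)) ^+ K)).
  rewrite lerXn2r ?nnegrE ?mulr_ge0 ?addr_ge0 //.
  rewrite natrD mulrDr mulr1 lerD2l; have := ler_wpM2r (ler0n R c) n1; lra.
rewrite exprSr (_ : n%:R * (1 + c%:R) = n%:R * a * ((1 + c%:R) / a)); last first.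
  by field; rewrite lt0r_neq0.
rewrite exprMn ler_wpM2l ?exprn_ge0 //.
by rewrite -ler_pdivrMr.
Qed.

Lemma exists_triangular_bracket (n : nat) :
  exists r, (r * r.+1 <= 4 * n)%N && (4 * n < r.+1 * r.+2)%N.
Proof.
have ex0 : exists r, (r * r.+1 <= 4 * n)%N by exists 0%N.
have bd r : (r * r.+1 <= 4 * n)%N -> (r <= 4 * n)%N by nia.
by have [r rn rmax] := ex_maxnP ex0 bd; exists r; rewrite rn ltnNge /=; apply/negP => /rmax; lia.
Qed.

Lemma leq_expl (m n e : nat) : (m <= n)%N -> (m ^ e <= n ^ e)%N.
Proof. by case: e => // e mn; rewrite leq_exp2r. Qed.

(** Here [r] is about 2 sqrt n, so the left side is at most (r+2)^(4r), which is subexponential in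
    n. *)
Lemma low_growth (x : R) : 1 < x -> exists2 C : R, 0 < C & forall n r,
  (r * r.+1 <= 4 * n)%N -> (4 * n < r.+1 * r.+2)%N ->
  ((((2 * n).+1 ^ 2).+1 ^ r)%N)%:R <= C * x ^+ n.
Proof.
(* The exponent is 4 * 4: the base is at most (r+2)^4, and the comparison is made between fourth
   powers because r^2 <= 4n. The finitely many r < r0 go into the constant [C]. *)
move=> x1; have [r0 Hr0] := exp_beats_poly 16 2 x1.
pose C : R := (((r0.+2 ^ 4) ^ r0)%N)%:R.
have C1 : 1 <= C by rewrite /C ler1n expn_gt0 expn_gt0.
have x0 : 0 < x by lra.
exists C; first lra.
move=> n r rn nr; have xn1 : 1 <= x ^+ n by rewrite exprn_ege1 // ltW.
have base : (((2 * n).+1 ^ 2).+1 <= r.+2 ^ 4)%N.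
  rewrite (_ : r.+2 ^ 4 = (r.+2 * r.+2) * (r.+2 * r.+2))%N; last by rewrite !expnS expn0; lia.
  have : (2 * (2 * n).+1 <= r.+2 * r.+2)%N by nia.
  move: (r.+2 * r.+2)%N => y; rewrite !expnS expn0; nia.
have [rr0|r0r] := ltnP r r0.
  apply: (@le_trans _ _ C); last by rewrite ler_peMr //; lra.
  rewrite ler_nat; apply: leq_trans (leq_expl r base) _.
  apply: leq_trans (_ : (r.+2 ^ 4) ^ r0 <= _)%N.
    by rewrite leq_pexp2l ?expn_gt0 // ltnW.
  by apply/leq_expl/leq_expl; lia.
apply: (@le_trans _ _ (x ^+ n)); last by rewrite ler_peMl // exprn_ge0 // ltW.
rewrite -(@ler_pXn2r _ 4) ?nnegrE ?exprn_ge0 ?(ltW x0) //.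
apply: (@le_trans _ _ (x ^+ (r * r))); last first.
  by rewrite -exprM ler_eXn2l //; nia.
rewrite exprM; apply: (@le_trans _ _ (((r + 2)%:R ^+ 16) ^+ r)); last first.
  by rewrite lerXn2r ?nnegrE ?exprn_ge0 ?(ltW x0) // Hr0.
rewrite -!natrX ler_nat -!expnM.
apply: leq_trans (_ : ((r.+2 ^ 4) ^ (r * 4)) <= _)%N; first exact: leq_expl.
by rewrite -expnM addn2 leq_pexp2l //; lia.
Qed.

(** For large [M], (q+M+2)^2 <= x^M. Raising this to the number w of wraps and using Mw <= 2n gives
    the square of the claim. *)
Lemma wrap_growth (x : R) (q : nat) : 1 < x -> exists M0, forall M n, (M0 <= M)%N -> (0 < M)%N ->
  (((q + M).+2 ^ (2 * n %/ M))%N)%:R <= x ^+ n.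
Proof.
move=> x1; have [M0 H] := exp_beats_poly 2 q.+2 x1.
have x0 : 0 < x by lra.
exists M0 => M n M0M M_gt0; set w := (2 * n %/ M)%N.
rewrite -(@ler_pXn2r _ 2) ?nnegrE ?exprn_ge0 ?(ltW x0) //.
apply: (@le_trans _ _ (x ^+ (M * w))); last first.
  by rewrite -exprM ler_eXn2l // mulnC [(n * 2)%N]mulnC leq_divM.
rewrite exprM; apply: (@le_trans _ _ (((M + q.+2)%:R ^+ 2) ^+ w)); last first.
  by rewrite lerXn2r ?nnegrE ?exprn_ge0 ?(ltW x0) // H.
by rewrite -!natrX ler_nat -!expnM mulnC (_ : (q + M).+2 = (M + q.+2))%N //; lia.
Qed.
End Growth.

(** * Geometrically dominated complex series *)

Section ComplexSeries.
Variable R : realType.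
Implicit Types (u : nat -> R[i]) (C x : R).

Lemma cabs_le_ReIm (z : R[i]) : cabs z <= `|complex.Re z| + `|complex.Im z|.
Proof.
rewrite /cabs normc_def /= -[leRHS]ger0_norm ?addr_ge0 // -sqrtr_sqr ler_sqrt ?sqr_ge0 //.
rewrite sqrrD !real_normK ?num_real //.
have := mulr_ge0 (normr_ge0 (complex.Re z)) (normr_ge0 (complex.Im z)); lra.
Qed.

Lemma Re_le_cabs (z : R[i]) : `|complex.Re z| <= cabs z.
Proof. by have := normc_ge_Re z; rewrite normE lecR. Qed.

Lemma Im_le_cabs (z : R[i]) : `|complex.Im z| <= cabs z.
Proof.
rewrite /cabs normc_def /= -sqrtr_sqr ler_sqrt ?addr_ge0 ?sqr_ge0 //.
by rewrite lerDr sqr_ge0.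
Qed.

Lemma dominated_series_cvg (a : nat -> R) C x : 0 <= x < 1 ->
  (forall n, `|a n| <= C * x ^+ n) -> cvgn (series a).
Proof.
case/andP=> x0 x1 aC; apply: normed_cvg.
apply: (@series_le_cvg _ _ (geometric C x)) => [||n|].
- by move=> n; exact: normr_ge0.
- by move=> n; apply: le_trans (normr_ge0 _) (aC n).
- exact: aC.
- by apply: is_cvg_geometric_series; rewrite ger0_norm.
Qed.

Lemma cvg_complex (s : nat -> R[i]) (a b : R) :
  ((fun n => complex.Re (s n)) @ \oo --> a) -> ((fun n => complex.Im (s n)) @ \oo --> b) ->
  s @ \oo --> (a +i* b)%C.
Proof.
move=> sa sb; apply/cvgrPdist_lt => eps eps0.
(* A positive element of [R[i]] is real. *)
have [e e0 ->] : exists2 e : R, 0 < e & eps = (e%:C)%C.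
  exists (complex.Re eps); move: eps0; case: eps => er ei; rewrite ltcE /=.
    by case/andP.
  by case/andP => /eqP ->.
have e20 : 0 < e / 2 by lra.
move/cvgrPdist_lt: sa => /(_ _ e20) [N1 _ H1].
move/cvgrPdist_lt: sb => /(_ _ e20) [N2 _ H2].
exists (maxn N1 N2) => // n /=; rewrite geq_max => /andP[n1 n2].
rewrite ltr_cabs; apply: le_lt_trans (cabs_le_ReIm _) _.
have := H1 n n1; have := H2 n n2; case: (s n) => sr si /=; lra.
Qed.

Lemma geometric_tail_le (u : nat -> R[i]) C x N d : 0 <= x < 1 -> 0 <= C ->
  (forall n, cabs (u n) <= C * x ^+ n) ->
  cabs (\sum_(N <= i < N + d) u i) <= C * x ^+ N / (1 - x).
Proof.
case/andP=> x0 x1 C0 uC; apply: le_trans (cabs_sum _ _ _) _.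
apply: (@le_trans _ _ (\sum_(N <= i < N + d) C * x ^+ i)); first exact: ler_sum.
have x1' : 0 < 1 - x by lra.
rewrite ler_pdivlMr //.
suff -> : (\sum_(N <= i < N + d) C * x ^+ i) * (1 - x) = C * x ^+ N - C * x ^+ (N + d).
  by rewrite gerBl mulr_ge0 // exprn_ge0.
elim: d => [|d IHd]; first by rewrite addn0 big_geq // mul0r subrr.
rewrite addnS big_nat_recr ?leq_addr //= mulrDl IHd exprS; ring.
Qed.

Lemma complex_series_cvg u C x : 0 <= x < 1 ->
  (forall n, cabs (u n) <= C * x ^+ n) ->
  exists2 l : R[i], series u @ \oo --> l &
    forall N, cabs (l - \sum_(0 <= i < N) u i) <= C * x ^+ N / (1 - x).
Proof.
move=> x01 uC; have [x0 x1] := andP x01.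
have C0 : 0 <= C by apply: le_trans (cabs_ge0 _) (le_trans (uC 0%N) _); rewrite expr0 mulr1.
have cR : cvgn (series (fun n => complex.Re (u n))).
  by apply: (dominated_series_cvg x01) => n; apply: le_trans (Re_le_cabs _) (uC n).
have cI : cvgn (series (fun n => complex.Im (u n))).
  by apply: (dominated_series_cvg x01) => n; apply: le_trans (Im_le_cabs _) (uC n).
pose l := (limn (series (fun n => complex.Re (u n))) +i* limn (series (fun n => complex.Im (u n))))%C.
have sl : series u @ \oo --> l.
  apply: cvg_complex.
    have -> // : (fun n => complex.Re (series u n)) = series (fun n => complex.Re (u n)).
    by apply/funext => n; rewrite /series /= raddf_sum.
  have -> // : (fun n => complex.Im (series u n)) = series (fun n => complex.Im (u n)).
  by apply/funext => n; rewrite /series /= raddf_sum.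
exists l => // N; apply/ler_addgt0Pr => e e0.
have ec0 : 0 < (e%:C)%C by rewrite ltcR.
move/cvgrPdist_lt: sl => /(_ _ ec0) [M _ HM].
have := HM (N + M)%N (leq_addl _ _); rewrite ltr_cabs /series /= => lM.
have := geometric_tail_le N M x01 C0 uC.
have -> : l - \sum_(0 <= i < N) u i = (l - \sum_(0 <= i < N + M) u i) + \sum_(N <= i < N + M) u i.
  by rewrite (@big_cat_nat _ _ _ N 0 (N + M)) ?leq_addr //= opprD addrA subrK.
have := cabsD (l - \sum_(0 <= i < N + M) u i) (\sum_(N <= i < N + M) u i).
lra.
Qed.

End ComplexSeries.

(** The open balls of radius 1 - 1/(n+1) cover the unit disk; the largest one in a finite subcover
    gives [rho]. *)
Lemma compact_in_smaller_disk (R : realType) (K : set R[i]) :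
  compact K -> K `<=` [set z : R[i] | `|z| < 1] ->
  exists2 rho : R, 0 <= rho < 1 & forall z, K z -> cabs z <= rho.
Proof.
rewrite compact_cover => cK K1.
pose f (n : nat) := ball (0 : R[i]) ((1 - n.+1%:R^-1 : R)%:C)%C.
have [||D _ KD] := cK nat setT f.
- by move=> n _; apply: ball_open.
- move=> z /K1 /=; rewrite (_ : 1 = ((1 : R)%:C)%C) // ltr_cabs => z1.
  have z1' : 0 < 1 - cabs z by rewrite subr_gt0.
  pose n := Num.Def.archi_bound (1 - cabs z)^-1; exists n => //.
  rewrite /f -ball_normE /ball_ /= sub0r normrN ltr_cabs.
  have : (1 - cabs z)^-1 < n.+1%:R.
    apply: lt_le_trans (archi_boundP _) _; first by rewrite invr_ge0 ltW.
    by rewrite ler_nat.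
  have n0 : 0 < n.+1%:R :> R by rewrite ltr0n.
  rewrite -(ltf_pV2 (_ : n.+1%:R \is Num.pos)) ?posrE ?invr_gt0 // invrK => h.
  by rewrite ltrBrDl -ltrBrDr.
exists (1 - (\max_(i <- D) i).+1%:R^-1).
  have p0 : 0 < (\max_(i <- D) i).+1%:R^-1 :> R by rewrite invr_gt0.
  have p1 : (\max_(i <- D) i).+1%:R^-1 <= 1 :> R by rewrite invf_le1 // ler1n.
  by rewrite subr_ge0 p1 gtrBl p0.
move=> z /KD[n nD]; rewrite /f -ball_normE /ball_ /= sub0r normrN ltr_cabs => zn.
apply: le_trans (ltW zn) _; rewrite lerD2l lerN2 lef_pV2 ?posrE // ler_nat ltnS.
exact: leq_bigmax_seq.
Qed.

Lemma specdet_poly (R : realType) (G : mgraph) (D : nat) (z : R[i]) :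
  (forall n, (D <= n)%N -> sd_coef G R n = 0) ->
  specdet G z = (\poly_(n < D) sd_coef G R n).[z].
Proof.
move=> G0; rewrite /specdet; apply: lim_near_cst; first exact: norm_hausdorff.
exists D => // n /= Dn; rewrite /series /= horner_poly.
rewrite (@big_cat_nat _ _ _ D) //= big_mkord [X in _ + X]big_nat_cond.
by rewrite [X in _ + X]big1 ?addr0 // => i /andP[/andP[Di _] _]; rewrite G0 // mul0r.
Qed.

Lemma eqvn_mull (k p q i j : nat) : eqvn (k * p) q i j -> eqvn p q i j.
Proof.
case/orP => [/eqP ->|/andP[qij /eqP ij]]; first by rewrite /eqvn eqxx.
apply/orP; right; rewrite qij /=.
by rewrite -(modn_dvdm i (dvdn_mull k (dvdnn p))) ij modn_dvdm // dvdn_mull.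
Qed.

(** * Spectral determinants of a periodic wedge and its quotients *)

Section Main.
Variables (R : realType) (Phi : Sigma -> label) (p q : nat).
Hypothesis wedge : periodic_wedge Phi p q.

Let p_gt0 : (0 < p)%N. Proof. by case: wedge. Qed.

Lemma wedge_lt v : Phi v <> LE -> (vi v < vj v)%N.
Proof.
case: wedge => _ _ PE nE; have /andP[_] := SigmaP v; rewrite leq_eqVlt.
by case/predU1P => // ij; case: nE; apply/PE; rewrite /eqvn ij eqxx.
Qed.

Lemma wedge_eqv k v w : eqvS (k * p) q v w -> Phi v = Phi w.
Proof.
case: wedge => _ P_eqv _ vw; apply: P_eqv; case/orP: vw => /andP[/eqvn_mull vw /eqvn_mull vw'].
  by rewrite /eqvS vw vw'.
by rewrite /eqvS vw vw' orbT.
Qed.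

Lemma sd_coef_GammaK k n : (0 < k)%N ->
  sd_coef (GammaK Phi p q k) R n = sd_coef (foldedG Phi (red (k * p) q)) R n.
Proof.
move=> k0; apply: sd_coef_quotG; first by rewrite muln_gt0 k0 p_gt0.
exact: wedge_eqv.
Qed.

Lemma sd_coef_GammaK_small k n : (0 < k)%N -> (2 * n < k)%N ->
  sd_coef (GammaK Phi p q k) R n = sd_coef (Gamma Phi) R n.
Proof.
move=> k0 nk; rewrite (sd_coef_GammaK n k0).
have M_gt0 : (0 < k * p)%N by rewrite muln_gt0 k0 p_gt0.
have nM : (2 * n < k * p)%N by rewrite (leq_trans nk) // leq_pmulr // p_gt0.
exact: (@sd_coef_folded_small Phi (k * p) q M_gt0 wedge_lt R n nM).
Qed.

Lemma sd_coef_growth (x : R) : 1 < x -> exists2 C : R, 0 < C & exists k0,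
  forall k n, (k0 <= k)%N -> (0 < k)%N -> cabs (sd_coef (GammaK Phi p q k) R n) <= C * x ^+ n.
Proof.
(* With x = y^2, one factor y^n pays for the low edges and the other for the wraps. *)
move=> x1; have [y y1 <-] := root_gt1 1 x1.
have [C C0 HC] := low_growth y1; have [M0 HM] := wrap_growth q y1.
exists C => //; exists M0 => k n kM k0.
have M_gt0 : (0 < k * p)%N by rewrite muln_gt0 k0 p_gt0.
have [r /andP[rn nr]] := exists_triangular_bracket n.
have := @norm_sd_coef_folded Phi (k * p) q M_gt0 wedge_lt n R r nr.
rewrite -(sd_coef_GammaK n k0) normE -(rmorph_nat (real_complex R)) lecR natrM.
move/le_trans; apply; rewrite exprAC expr2 mulrA.
apply: ler_pM => //; first exact: HC.
by apply: HM => //; apply: leq_trans kM _; rewrite leq_pmulr.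
Qed.

(** Each coefficient of [Gamma] is also one of [GammaK] for large [k], so the uniform bound is
    inherited. *)
Lemma sd_coef_Gamma_growth (x C : R) k0 :
  (forall k n, (k0 <= k)%N -> (0 < k)%N -> cabs (sd_coef (GammaK Phi p q k) R n) <= C * x ^+ n) ->
  forall n, cabs (sd_coef (Gamma Phi) R n) <= C * x ^+ n.
Proof.
move=> HC n; rewrite -(@sd_coef_GammaK_small (maxn k0 (2 * n).+1)); try lia.
by apply: HC; lia.
Qed.

Definition quotient_poly k : {poly R[i]} :=
  \poly_(n < ((q + k * p).+1 ^ 2).+1) sd_coef (GammaK Phi p q k) R n.

Lemma specdet_GammaK k z : (0 < k)%N ->
  specdet (GammaK Phi p q k) z = (quotient_poly k).[z].
Proof.
move=> k0; apply: specdet_poly => n nk; rewrite (sd_coef_GammaK n k0).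
have M_gt0 : (0 < k * p)%N by rewrite muln_gt0 k0 p_gt0.
exact: (@sd_coef_folded_large Phi (k * p) q M_gt0 wedge_lt R n nk).
Qed.

Lemma quotient_poly0 k : (quotient_poly k).[0] = 1.
Proof. by rewrite horner_coef0 coef_poly /= sd_coef0. Qed.

Lemma specdet_approx (G : mgraph) (C x rho : R) : 0 <= rho -> 0 <= x -> x * rho < 1 ->
  (forall n, cabs (sd_coef G R n) <= C * x ^+ n) ->
  forall z N, cabs z <= rho ->
  cabs (specdet G z - \sum_(0 <= n < N) sd_coef G R n * z ^+ n) <=
    C * (x * rho) ^+ N / (1 - x * rho).
Proof.
move=> rho0 x0 xr HC z N zr.
have xr01 : 0 <= x * rho < 1 by rewrite mulr_ge0.
have C0 : 0 <= C by apply: le_trans (cabs_ge0 _) (le_trans (HC 0%N) _); rewrite expr0 mulr1.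
have HCz n : cabs (sd_coef G R n * z ^+ n) <= C * (x * rho) ^+ n.
  rewrite cabsM cabsX exprMn mulrA; apply: ler_pM; rewrite ?cabs_ge0 ?exprn_ge0 ?cabs_ge0 //.
  by rewrite lerXn2r ?nnegrE ?cabs_ge0.
have [l sl lN] := complex_series_cvg xr01 HCz.
have -> : specdet G z = l by apply: cvg_lim => //; exact: norm_hausdorff.
exact: lN.
Qed.

(** Cut both series at [N]: the first [N] coefficients agree once k >= 2N, and each tail is below
    e/2, uniformly in [k]. *)
Lemma specdet_uniform (rho e : R) : 0 <= rho < 1 -> 0 < e ->
  exists N, forall k, (0 < k)%N -> (N <= k)%N -> forall z, cabs z <= rho ->
    cabs (specdet (GammaK Phi p q k) z - specdet (Gamma Phi) z) < e.
Proof.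
(* A growth rate above 1 that still satisfies x rho < 1. *)
case/andP=> rho0 rho1 e0; pose x : R := 2 / (1 + rho).
have x1 : 1 < x by rewrite /x ltr_pdivlMr; lra.
have xr : x * rho < 1 by rewrite /x mulrAC ltr_pdivrMr; lra.
have x0 : 0 <= x by lra.
have [C C0 [k0 HC]] := sd_coef_growth x1.
have HC' := sd_coef_Gamma_growth HC.
have xr01 : 0 <= x * rho < 1 by rewrite mulr_ge0.
have d0 : 0 < e * (1 - x * rho) / (2 * C) by rewrite divr_gt0 ?mulr_gt0 // subr_gt0.
have [N HN] := exp_null xr01 d0.
have tail : C * (x * rho) ^+ N / (1 - x * rho) < e / 2.
  rewrite ltr_pdivrMr ?subr_gt0 //; move: HN; rewrite ltr_pdivlMr ?mulr_gt0 //.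
  lra.
exists (maxn k0 (2 * N)) => k k_gt0; rewrite geq_max => /andP[kk0 kN] z zr.
have A1 := specdet_approx rho0 x0 xr (fun n => HC k n kk0 k_gt0) N zr.
have A2 := specdet_approx rho0 x0 xr HC' N zr.
have S : \sum_(0 <= n < N) sd_coef (GammaK Phi p q k) R n * z ^+ n =
         \sum_(0 <= n < N) sd_coef (Gamma Phi) R n * z ^+ n.
  apply: eq_big_nat => n /andP[_ nN].
  have nk : (2 * n < k)%N by clear -nN kN; lia.
  by rewrite (sd_coef_GammaK_small k_gt0 nk).
rewrite S in A1; set s := \sum_(0 <= n < N) _ in A1 A2.
have := cabsD (specdet (GammaK Phi p q k) z - s) (s - specdet (Gamma Phi) z).
rewrite addrA subrK [cabs (s - _)]cabsB; lra.
Qed.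

End Main.

Theorem theorem5p11 (R : realType) (Phi : Sigma -> label) (p q : nat) :
  periodic_wedge Phi p q ->
  (* P_{Gamma_k} -> P_Gamma uniformly on compact subsets of the unit disk *)
  (forall K : set R[i], compact K -> K `<=` [set z : R[i] | `|z| < 1] ->
     forall eps : R, 0 < eps ->
     exists N : nat, forall k : nat, (0 < k)%N -> (N <= k)%N ->
       forall z, K z ->
         `|specdet (GammaK Phi p q k) z - specdet (Gamma Phi) z| < (eps%:C)%C)
  /\
  (* roots of P_Gamma in the disk are limits of roots of P_{Gamma_k} *)
  (forall z : R[i], `|z| < 1 -> specdet (Gamma Phi) z = 0 ->
     forall eps : R, 0 < eps ->
     exists N : nat, forall k : nat, (0 < k)%N -> (N <= k)%N ->
       exists w : R[i], specdet (GammaK Phi p q k) w = 0 /\ `|w - z| < (eps%:C)%C).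
Proof.
move=> wedge; split=> [K cK K1 eps eps0|z z1 fz eps eps0].
  have [rho rho01 Krho] := compact_in_smaller_disk cK K1.
  have [N HN] := specdet_uniform wedge rho01 eps0.
  by exists N => k k0 kN z Kz; rewrite ltr_cabs HN // Krho.
have {}z1 : cabs z < 1.
  by move: z1; rewrite (_ : 1 = ((1 : R)%:C)%C) // ltr_cabs.
have z0 := cabs_ge0 z.
pose rho := (1 + cabs z) / 2.
have rho01 : 0 <= rho < 1 by apply/andP; rewrite /rho; split; lra.
have zrho : cabs z < rho by rewrite /rho; lra.
have unif e : 0 < e -> exists N, forall k, (N <= k)%N -> forall w, cabs w <= rho ->
    cabs ((quotient_poly R Phi p q k).[w] - specdet (Gamma Phi) w) < e.
  move=> e0; have [N HN] := specdet_uniform wedge rho01 e0.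
  exists N.+1 => k kN w wr; rewrite -(specdet_GammaK wedge); last lia.
  by apply: HN => //; lia.
have cauchy e : 0 < e -> exists N, forall k l, (N <= k)%N -> (N <= l)%N ->
    forall w, cabs w <= rho ->
    cabs ((quotient_poly R Phi p q k).[w] - (quotient_poly R Phi p q l).[w]) <= e.
  move=> e0; have e20 : 0 < e / 2 by lra.
  have [N HN] := unif _ e20; exists N => k l kN lN w wr.
  have := HN k kN w wr; have := HN l lN w wr.
  rewrite [cabs (_.[w] - specdet _ w)]cabsB => lw kw.
  have := cabsD ((quotient_poly R Phi p q k).[w] - specdet (Gamma Phi) w)
    (specdet (Gamma Phi) w - (quotient_poly R Phi p q l).[w]).
  rewrite addrA subrK; lra.
have [N0 HN0] := cauchy 1 ltr01.
pose P0 := quotient_poly R Phi p q N0.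
(* From rank [N0] on, all approximants stay within 1 of [P0] on the disk, and the sum bounds [P0]
   there. *)
pose C := 1 + \sum_(i < size P0) cabs P0`_i * rho ^+ i.
have bound k : (N0 <= k)%N -> forall w, cabs w <= rho ->
    cabs (quotient_poly R Phi p q k).[w] <= C.
  move=> kN w wr; rewrite -[(quotient_poly _ _ _ _ k).[w]](subrK P0.[w]).
  apply: le_trans (cabsD _ _) _; apply: lerD; first exact: HN0.
  apply: le_trans (horner_cabs_le _ _) _; apply: ler_sum => i _.
  by rewrite ler_wpM2l ?cabs_ge0 // lerXn2r ?nnegrE ?cabs_ge0 //; lra.
have zroot e : 0 < e -> exists N, forall k, (N <= k)%N ->
    cabs (quotient_poly R Phi p q k).[z] < e.
  move=> e0; have [N HN] := unif e e0; exists N => k kN.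
  by have := HN k kN z (ltW zrho); rewrite fz subr0.
have [N HN] := hurwitz_poly zrho (fun k _ => quotient_poly0 R Phi p q k) bound cauchy zroot eps0.
exists N => k k0 kN; have [w rw wz] := HN k kN.
exists w; split; last by rewrite ltr_cabs.
by rewrite (specdet_GammaK wedge) //; apply/eqP.
Qed.
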